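(* Thompson's group $F$ is in $TC_\rho$ with $\rho$ linear. More specifically, the Cayley complex $X$ of the presentation $$F=\langle x_0,x_1 \mid [x_0x_1^{-1},x_0^{-1}x_1x_0],\ [x_0x_1^{-1},x_0^{-2}x_1x_0^2] \rangle$$ has a 1-combing admitting the radial tameness function $\rho(q)=4q+45$.
   Context: Let $G=\langle A\mid R\rangle$ be a finitely presented group with $A$ inverse-closed and $R=\{r_1,\dots,r_k\}$, $r_i$ of length $n_i$; let $X$ be its Cayley 2-complex, with $X^0=G$, $X^1$ the Cayley graph, $\epsilon$ the identity vertex. Levels: for $g\in X^0$, $\mathrm{lev}(g)$ is the word length of $g$ over $A$; for $x$ in the interior of an edge with endpoints $g,h$, $\mathrm{lev}(x)=\frac{\mathrm{lev}(g)+\mathrm{lev}(h)}{2}+\frac14$; for $x$ in the interior of a 2-cell with boundary vertices $g_1,\dots,g_n$ (listed along the boundary), $\mathrm{lev}(x)=\frac{\mathrm{lev}(g_1)+\cdots+\mathrm{lev}(g_n)}{n}+\frac14+\frac1c$ where $c=4n_1n_2\cdots n_k+1$. A 1-combing is a continuous $\Psi:X^1\times[0,1]\to X$ with $\Psi(x,0)=\epsilon$, $\Psi(x,1)=x$ for all $x\in X^1$, and $\Psi(X^0\times[0,1])\subseteq X^1$. A function $\rho:\mathbb{Q}\to\mathbb{R}_+$ is a radial tameness function for $\Psi$ if for all $x\in X^1$, $0\le s<t\le1$ and $q\in\mathbb{Q}$, $\mathrm{lev}(\Psi(x,s))>\rho(q)$ implies $\mathrm{lev}(\Psi(x,t))>q$.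 The pair (group, presentation) is in $TC_\rho$ if its Cayley complex admits a 1-combing with radial tameness function $\rho$. *)

(* Defs.v *)
From HB Require Import structures.
From Stdlib Require Import Relations.
From mathcomp Require Import all_boot all_order all_algebra.
From mathcomp Require Import all_classical all_reals.
From mathcomp Require Import topology normedtype.
From mathcomp Require Import Rstruct Rstruct_topology.
From Stdlib Require Rdefinitions.

Set Implicit Arguments.
Unset Strict Implicit.
Unset Printing Implicit Defensive.
Import Order.TTheory GRing.Theory Num.Theory.
Local Open Scope classical_set_scope.
Local Open Scope ring_scope.

Notation R := Rdefinitions.R.

(* Words over the inverse-closed alphabet A = {x0, x1, x0^-1, x1^-1}.  *)
(* A letter (j, e) is x_j (j = false : x0, j = true : x1), inverted    *)
(* iff e = true.                                                       *)
Definition letter := (bool * bool)%type.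
Definition word := seq letter.

Definition x0 : word := [:: (false, false)].
Definition x1 : word := [:: (true, false)].
Definition linv (a : letter) : letter := (a.1, ~~ a.2).
Definition winv (w : word) : word := rev (map linv w).
Definition comm (a b : word) : word := a ++ b ++ winv a ++ winv b.

Definition rel1 : word := comm (x0 ++ winv x1) (winv x0 ++ x1 ++ x0).
Definition rel2 : word :=
  comm (x0 ++ winv x1) (winv x0 ++ winv x0 ++ x1 ++ x0 ++ x0).
Definition relator (i : bool) : word := if i then rel2 else rel1.

Inductive wstep : word -> word -> Prop :=
| wstep_free (u v : word) (a : letter) : wstep (u ++ [:: a; linv a] ++ v) (u ++ v)
| wstep_rel (u v : word) (i : bool) : wstep (u ++ relator i ++ v) (u ++ v).

Definition wequiv : relation word := clos_refl_sym_trans word wstep.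

Definition G := {S : set word | exists w, S = wequiv w}.
Definition cls (w : word) : G := exist _ (wequiv w) (ex_intro _ w erefl).
Definition repr (g : G) : word := projT1 (cid (proj2_sig g)).

Lemma clsK (g : G) : cls (repr g) = g.
Proof.
case: g => S HS; rewrite /cls /repr /=.
case: (cid HS) => w /= Hw; subst S.
by congr exist; exact: Prop_irrelevance.
Qed.

Definition gmul (g : G) (u : word) : G := cls (repr g ++ u).
Definition eps : G := cls [::].

Lemma wlen_ex (g : G) : exists n, `[< exists w : word, size w = n /\ cls w = g >].
Proof. by exists (size (repr g)); apply/asboolP; exists (repr g); rewrite clsK. Qed.
Definition wlen (g : G) : nat := ex_minn (wlen_ex g).

(* Points of the Cayley 2-complex X.                                  *)
(*  PV g        : the vertex g                                        *)
(*  PE g j t    : interior point of the edge from g to g x_j, at      *)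
(*                parameter t in (0,1)                                *)
(*  PC g i p    : interior point of the 2-cell attached along the     *)
(*                relator r_i read from g; p in the open square       *)
(*                (0,1)^2 (model of the open 2-disk)                  *)
Definition oint := {t : R | 0 < t < 1}.
Definition osq := {p : R * R | (0 < p.1 < 1) && (0 < p.2 < 1)}.

Inductive pt :=
| PV of G
| PE of G & bool & oint
| PC of G & bool & osq.

HB.instance Definition _ := gen_eqMixin pt.
HB.instance Definition _ := gen_choiceMixin pt.

Definition mkE (g : G) (j : bool) (t : R) : pt :=
  if @insub R (fun t => 0 < t < 1) _ t is Some t' then PE g j t' else PV g.
Definition mkC (g : G) (i : bool) (p : R * R) : pt :=
  if @insub (R * R)%type (fun p : R * R => (0 < p.1 < 1) && (0 < p.2 < 1)) _ p
  is Some p' then PC g i p' else PV g.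

Definition edge_map (g : G) (j : bool) (t : R) : pt :=
  if t <= 0 then PV g
  else if 1 <= t then PV (gmul g [:: (j, false)])
  else mkE g j t.

(* the point at position s in [0, size w) of the loop reading w from g *)
Definition loop_pt (g : G) (w : word) (s : R) : pt :=
  let k := Num.truncn s in
  let u := s - k%:R in
  if u == 0 then PV (gmul g (take k w))
  else match nth (false, false) w k with
       | (j, false) => mkE (gmul g (take k w)) j u
       | (j, true) => mkE (gmul g (take k.+1 w)) j (1 - u)
       end.

(* perimeter coordinate in [0,4) of a boundary point of [0,1]^2,
   going counterclockwise from (0,0) *)
Definition perim (p : R * R) : R :=
  if p.2 == 0 then p.1
  else if p.1 == 1 then 1 + p.2
  else if p.2 == 1 then 3 - p.1
  else 4 - p.2.

Definition cell_map (g : G) (i : bool) (p : R * R) : pt :=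
  if (0 < p.1 < 1) && (0 < p.2 < 1) then mkC g i p
  else loop_pt g (relator i) (perim p * (size (relator i))%:R / 4).

Definition I01 : set R := [set t | 0 <= t <= 1].
Definition sq01 : set (R * R) := [set p | 0 <= p.1 <= 1 /\ 0 <= p.2 <= 1].

Definition relopen {T : topologicalType} (D S : set T) :=
  forall x, D x -> S x -> \forall y \near x, D y -> S y.

(* CW (weak) topology: U is open iff its preimage under every
   characteristic map is open in the corresponding closed cell
   (the condition for 0-cells is vacuous). *)
Definition cw_open (U : set pt) : Prop :=
  (forall g j, relopen I01 (edge_map g j @^-1` U)) /\
  (forall g i, relopen sq01 (cell_map g i @^-1` U)).

Lemma relopenT {T : topologicalType} (D : set T) : relopen D setT.
Proof. by move=> x _ _; apply: nearW. Qed.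

Lemma relopenI {T : topologicalType} (D A B : set T) :
  relopen D A -> relopen D B -> relopen D (A `&` B).
Proof.
move=> hA hB x Dx [Ax Bx].
by apply: filterS2 (hA x Dx Ax) (hB x Dx Bx) => y h1 h2 Dy; split; auto.
Qed.

Lemma relopenU {T : topologicalType} (D : set T) (I : Type) (f : I -> set T) :
  (forall i, relopen D (f i)) -> relopen D (\bigcup_i f i).
Proof.
move=> h x Dx [i _ fix_].
by apply: filterS (h i x Dx fix_) => y hy Dy; exists i => //; apply: hy.
Qed.

Lemma cw_openT : cw_open setT.
Proof. by split=> *; apply: relopenT. Qed.

Lemma cw_openI : setI_closed cw_open.
Proof.
move=> A B [hA1 hA2] [hB1 hB2]; split=> g j.
- exact: relopenI (hA1 g j) (hB1 g j).
- exact: relopenI (hA2 g j) (hB2 g j).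
Qed.

Lemma cw_openU (I : Type) (f : I -> set pt) :
  (forall i, cw_open (f i)) -> cw_open (\bigcup_i f i).
Proof.
move=> h; split=> g j.
- have -> : edge_map g j @^-1` (\bigcup_i f i) =
            \bigcup_i (edge_map g j @^-1` f i) by [].
  by apply: relopenU => i; case: (h i) => h1 _; apply: h1.
- have -> : cell_map g j @^-1` (\bigcup_i f i) =
            \bigcup_i (cell_map g j @^-1` f i) by [].
  by apply: relopenU => i; case: (h i) => _ h2; apply: h2.
Qed.

HB.instance Definition _ :=
  isOpenTopological.Build pt cw_openT cw_openI cw_openU.

Definition X0 : set pt := [set x | if x is PV _ then True else False].
Definition X1 : set pt := [set x | if x is PC _ _ _ then False else True].

Definition cconst : R := (4 * size rel1 * size rel2 + 1)%:R.

Definition lev (x : pt) : R :=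
  match x with
  | PV g => (wlen g)%:R
  | PE g j _ => ((wlen g)%:R + (wlen (gmul g [:: (j, false)]))%:R) / 2 + 1 / 4
  | PC g i _ =>
      (\sum_(k < size (relator i)) (wlen (gmul g (take k (relator i))))%:R)
        / (size (relator i))%:R + 1 / 4 + 1 / cconst
  end.

Definition one_combing (Psi : pt -> R -> pt) : Prop :=
  {within [set p : pt * R | X1 p.1 /\ I01 p.2],
     continuous (fun p : pt * R => Psi p.1 p.2)} /\
  (forall x, X1 x -> Psi x 0 = PV eps) /\
  (forall x, X1 x -> Psi x 1 = x) /\
  (forall x s, X0 x -> I01 s -> X1 (Psi x s)).

Definition radial_tameness (Psi : pt -> R -> pt) (rho : rat -> R) : Prop :=
  forall x s t (q : rat), X1 x -> 0 <= s -> s < t -> t <= 1 ->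
    lev (Psi x s) > rho q -> lev (Psi x t) > ratr q.

(* Main.v *)
(* F acts on sequences of finite trees: x_j splits the j-th tree, and a caret of one forest
   cancels against a caret of the other. This gives a faithful model in which x_0 moves a cursor
   and x_1 adds or removes a caret at the cursor. Let the room N(g) be the number of leaves of the
   smallest pair of forests containing g and its cursor; then N(g) <= |g| + 2 and |g| <= 4 N(g).

   Going from g to the leftmost removable caret and removing it defines a spanning tree of the
   Cayley graph along which N is monotone. It contains all x_0-edges. A pair of x_1-edges commuting
   with a merge on their left at distance 1 or 2 are opposite sides of a 2-cell all of whose other
   sides are better, and larger distances are reduced by merging the last two trees before the
   cursor. So every edge outside of the tree is filled by 2-cells recursively, without ever
   increasing N; hence N is nondecreasing along the combing paths, and the two bounds on N turn
   this into a linear radial tameness function. *)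

(* Faithfulness of the model and the combing both come from one induction principle, [flow_ind]: a
   property of edges holds everywhere once it is symmetric, holds on the tree, and passes from the
   other sides of a cell to the last one. For normal forms it shows that a state determines the
   group element; for homotopies it yields the combing.

   A cell may be used for its missing edge only if no vertex of the cell has larger N than both ends
   of that edge; otherwise a path would climb and come down again. Regrouping neighbouring trees
   keeps the leaves and can only lose some by cancellation, so the condition holds as soon as the
   missing side is a regrouping without cancellation. This decides which caret has to be treated
   first.

   N is defined at vertices only, while the levels of points in open cells are averages, so the two
   are compared with a margin. Vertices of a cell with at most 14 sides differ in length by at most
   7; with N(g) <= |g| + 2 this makes 9, which stays below the 11 in [at_level].

   All homotopies restrict at vertices to the same fixed tree paths, so those of different edges fit
   together. *)
Require Import Defs.
From Stdlib Require Import Relations.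
From mathcomp Require Import all_boot all_order all_algebra.
From mathcomp Require Import all_classical all_reals.
From mathcomp Require Import topology normedtype.
From mathcomp Require Import Rstruct Rstruct_topology.
From mathcomp Require Import lra zify.
Import Order.TTheory GRing.Theory Num.Theory.
Import numFieldNormedType.Exports.

Set Implicit Arguments.
Unset Strict Implicit.
Unset Printing Implicit Defensive.

(** * Trees and states *)

(* A state is a sequence of binary trees, almost all equal to [Leaf 0]; it stands for the
   element P Q^-1 of F, where P and Q are positive elements seen as forests with the same
   leaves. The nodes are the carets of Q, and the label of a leaf is its exponent in the
   normal form x_0^a0 x_1^a1 ... of P. *)
Inductive tree := Leaf of nat | Node of tree & tree.

Definition is_node (t : tree) : bool := if t is Node _ _ then true else false.

Definition cancels (l r : tree) : bool :=
  match l, r with Leaf _.+1, Leaf 0 => true | _, _ => false end.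

(* A caret of Q facing a caret of P cancels; on reduced trees [join] is then a bijection
   from pairs of trees to trees, which is what makes F act on states. *)
Definition join (l r : tree) : tree :=
  match l, r with Leaf a.+1, Leaf 0 => Leaf a | _, _ => Node l r end.

Definition halves (t : tree) : tree * tree :=
  if t is Node l r then (l, r) else
  if t is Leaf a then (Leaf a.+1, Leaf 0) else (t, t).

Fixpoint reduced (t : tree) : bool :=
  if t is Node l r then [&& reduced l, reduced r & ~~ cancels l r] else true.

Lemma halves_join (l r : tree) : halves (join l r) = (l, r).
Proof. by case: l => [[|a]|? ?]; case: r => [[|b]|? ?]. Qed.

Lemma join_halves (t : tree) : reduced t -> join (halves t).1 (halves t).2 = t.
Proof.
case: t => //= l r /and3P[_ _].
by case: l => [[|a]|? ?]; case: r => [[|b]|? ?].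
Qed.

Lemma joinP (t : tree) : reduced t ->
  exists l r, [/\ reduced l, reduced r & t = join l r].
Proof.
move=> rt; exists (halves t).1, (halves t).2; rewrite join_halves //; split=> //;
by case: t rt => //= l r /and3P[].
Qed.

Lemma reduced_join (l r : tree) : reduced l -> reduced r -> reduced (join l r).
Proof. by case: l => [[|a]|? ?]; case: r => [[|b]|? ?] //= h1 h2; rewrite ?h1 ?h2. Qed.

Lemma join_node (l r : tree) : ~~ cancels l r -> join l r = Node l r.
Proof. by case: l => [[|a]|? ?]; case: r => [[|b]|? ?]. Qed.

Definition state := nat -> tree.
Definition stl (ts : seq tree) : state := nth (Leaf 0) ts.
Definition st0 : state := stl [::].

(* In a state, tree 0 holds along its left spine the trees on the left of a cursor that
   points at tree 1. The generator x_j splits tree j, so x_0 moves the cursor. *)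
Definition split_head (s : state) : state := fun n =>
  match n with 0 => (halves (s 0)).1 | 1 => (halves (s 0)).2 | m.+2 => s m.+1 end.
Definition merge_head (s : state) : state := fun n =>
  match n with 0 => join (s 0) (s 1) | m.+1 => s m.+2 end.
Definition on_tail (f : state -> state) (s : state) : state := fun n =>
  match n with 0 => s 0 | m.+1 => f (fun k => s k.+1) m end.

Definition act (a : letter) (s : state) : state :=
  let f := if a.2 then merge_head else split_head in
  if a.1 then on_tail f s else f s.
Definition acts (w : word) (s : state) : state := foldl (fun s a => act a s) s w.

Lemma acts_cat (u v : word) (s : state) : acts (u ++ v) s = acts v (acts u s).
Proof. exact: foldl_cat. Qed.

Lemma acts_rcons (u : word) (a : letter) (s : state) :
  acts (rcons u a) s = act a (acts u s).
Proof. by rewrite /acts foldl_rcons. Qed.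

Lemma linvK (a : letter) : linv (linv a) = a.
Proof. by case: a => x y; rewrite /linv /= negbK. Qed.

Lemma act_split0 (l r : tree) (ts : seq tree) :
  act (false, false) (stl (join l r :: ts)) = stl (l :: r :: ts).
Proof. by apply/funext => -[|[|n]]; rewrite /act /= ?halves_join. Qed.

Lemma act_merge0 (l r : tree) (ts : seq tree) :
  act (false, true) (stl (l :: r :: ts)) = stl (join l r :: ts).
Proof. by apply/funext => -[|n]. Qed.

Lemma act_split1 (t l r : tree) (ts : seq tree) :
  act (true, false) (stl (t :: join l r :: ts)) = stl (t :: l :: r :: ts).
Proof. by apply/funext => -[|[|[|n]]]; rewrite /act /= ?halves_join. Qed.

Lemma act_merge1 (t l r : tree) (ts : seq tree) :
  act (true, true) (stl (t :: l :: r :: ts)) = stl (t :: join l r :: ts).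
Proof. by apply/funext => -[|[|n]]. Qed.

Lemma stl_rcons0 (ts : seq tree) : stl (rcons ts (Leaf 0)) = stl ts.
Proof.
apply/funext => n; rewrite /stl nth_rcons.
by case: ltngtP => // h; rewrite nth_default //; lia.
Qed.

(** * Leaf counts and the room taken by a state *)

Fixpoint labels (t : tree) : seq nat :=
  if t is Node l r then labels l ++ labels r else if t is Leaf a then [:: a] else [::].
Definition flabels (ts : seq tree) : seq nat := flatten (map labels ts).

(* The label of a leaf counts the carets of P whose leftmost leaf it is, so the carets
   starting at leaf j or later reach leaf j + (sum of the labels from j on);
   [fitting n L] says that all of them stay within the first n leaves. *)
Fixpoint fitting (n : nat) (L : seq nat) : bool :=
  if L is a :: L' then (a + sumn L' < n) && fitting n.-1 L' else true.

(** The condition [1 < size ts] forces the list to contain tree 1, so that the position of the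
    cursor is counted as well. *)
Definition fits (n : nat) (s : state) : Prop :=
  exists ts, [/\ 1 < size ts, all reduced ts, s = stl ts & fitting n (flabels ts)].

Definition supported (s : state) : Prop := exists n, fits n s.

Lemma fitting_size (n : nat) (L : seq nat) : fitting n L -> size L <= n.
Proof.
elim: L n => //= a L IH n /andP[h /IH]; lia.
Qed.

Lemma fitting_sumn (n : nat) (L : seq nat) : fitting n L -> sumn L <= n.
Proof. by case: L => //= a L /andP[h _]; exact: ltnW. Qed.

Lemma fitting_leq (m n : nat) (L : seq nat) : m <= n -> fitting m L -> fitting n L.
Proof.
elim: L m n => //= a L IH m n mn /andP[h1 /IH h2]; apply/andP; split; first by lia.
by apply: h2; lia.
Qed.

(** The context is part of the definition because the sums at the labels of A run over the replaced
    part, and the positions in B shift with its length. *)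
Definition lle (L' L : seq nat) : Prop :=
  forall n A B, fitting n (A ++ L ++ B) -> fitting n (A ++ L' ++ B).

Lemma lle_trans (L2 L1 L3 : seq nat) : lle L1 L2 -> lle L2 L3 -> lle L1 L3.
Proof. by move=> h1 h2 n A B h; apply/h1/h2. Qed.

Lemma lle_cat (L1 L2 M1 M2 : seq nat) :
  lle L1 M1 -> lle L2 M2 -> lle (L1 ++ L2) (M1 ++ M2).
Proof.
move=> h1 h2 n A B; rewrite -!catA => h.
by apply: (h1); rewrite catA; apply: h2; rewrite -catA.
Qed.

Lemma lle_cancel (a : nat) : lle [:: a] [:: a.+1; 0].
Proof.
move=> n A; elim: A n => [|c A IH] n B /=.
  case/and3P => h1 h2 h3; apply/andP; split; first by lia.
  by apply: fitting_leq h3; lia.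
case/andP => h1 h2; rewrite (IH _ B) // andbT.
move: h1; rewrite !sumn_cat /=; lia.
Qed.

Lemma lle_join (l r : tree) : lle (labels (join l r)) (labels l ++ labels r).
Proof.
by case: l => [[|a]|? ?]; case: r => [[|b]|? ?] //; exact: lle_cancel.
Qed.

Lemma fitting_split (n a : nat) (A B : seq nat) :
  fitting n (A ++ a :: B) -> fitting n.+1 (A ++ a.+1 :: 0 :: B).
Proof.
elim: A n => [|c A IH] n /=.
  case/andP => h1 h2; apply/and3P; split; [lia|lia|].
  by apply: fitting_leq h2.
case/andP => h1 /IH h2; rewrite (fitting_leq _ h2) ?andbT //; last by lia.
move: h1; rewrite !sumn_cat /=; lia.
Qed.

Lemma fitting_rcons0 (n : nat) (L : seq nat) :
  fitting n L -> fitting n.+1 (rcons L 0).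
Proof.
elim: L n => [|c L IH] n //= /andP[h1 /IH h2].
rewrite (fitting_leq _ h2) ?andbT //; last by lia.
by rewrite sumn_rcons; lia.
Qed.

Lemma flabels_cat (us vs : seq tree) : flabels (us ++ vs) = flabels us ++ flabels vs.
Proof. by rewrite /flabels map_cat flatten_cat. Qed.

Lemma flabels_rcons0 (ts : seq tree) : flabels (rcons ts (Leaf 0)) = rcons (flabels ts) 0.
Proof. by rewrite -cats1 flabels_cat /= -cats1. Qed.

Lemma fits_st0 : fits 2 st0.
Proof. by exists [:: Leaf 0; Leaf 0]; split=> //; apply/funext => -[|[|[|n]]]. Qed.

Lemma fits_pad (n : nat) (s : state) (k : nat) : fits n s ->
  exists ts, [/\ size ts >= k, all reduced ts, s = stl ts & fitting (n + k) (flabels ts)].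
Proof.
case=> ts [_ h2 h3 h4]; elim: k => [|k [us [g1 g2 g3 g4]]].
  by exists ts; rewrite addn0.
exists (rcons us (Leaf 0)); rewrite size_rcons all_rcons g2 stl_rcons0; split=> //.
by rewrite flabels_rcons0 addnS; exact: fitting_rcons0.
Qed.

(** Padding to three trees may cost the one unit that [fits_act] allows. The second alternative
    records that the third tree is then only padding, which a split can drop again. *)
Lemma fits_three (n : nat) (s : state) : fits n s ->
  exists t0 t1 t2 ts, [/\ [&& reduced t0, reduced t1, reduced t2 & all reduced ts],
    s = stl [:: t0, t1, t2 & ts], fitting n.+1 (flabels [:: t0, t1, t2 & ts]) &
    fitting n (flabels [:: t0, t1, t2 & ts]) \/ 
    [/\ t2 = Leaf 0, ts = [::] & fitting n (flabels [:: t0; t1])]].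
Proof.
case=> -[|t0 [|t1 [|t2 ts]]] [] //= _ h2 -> h4.
  exists t0, t1, (Leaf 0), [::]; split=> //.
  - exact: (esym (stl_rcons0 [:: t0; t1])).
  - have := fitting_rcons0 h4.
    by rewrite -(flabels_rcons0 [:: t0; t1]).
  - by right.
exists t0, t1, t2, ts; split=> //; first by apply: fitting_leq h4.
by left.
Qed.

Lemma fits_act (n : nat) (a : letter) (s : state) : fits n s -> fits n.+1 (act a s).
Proof.
case/fits_three => t0 [t1 [t2 [ts [/and4P[r0 r1 r2 rs] -> h4 h5]]]].
have aux (t : tree) (us vs : seq tree) : reduced t ->
    [&& 0 < size us + size vs, all reduced us & all reduced vs] ->
    (fitting n (flabels (us ++ t :: vs))) ->
    fits n.+1 (stl (us ++ (halves t).1 :: (halves t).2 :: vs)).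
  move=> rt /and3P[sz rus rvs] ft.
  exists (us ++ (halves t).1 :: (halves t).2 :: vs); split=> //.
  - by rewrite size_cat /=; lia.
  - rewrite all_cat /= rus rvs !andbT /=.
    by case: t rt {ft} => //= l r /and3P[-> ->].
  - move: ft; rewrite !flabels_cat /flabels /=.
    case: t {rt} => [b|l r] /=; first exact: fitting_split.
    by rewrite -!catA => ft; apply: fitting_leq ft.
case: a => -[] [].
- rewrite act_merge1; exists [:: t0, join t1 t2 & ts]; split=> //=.
    by rewrite r0 rs reduced_join.
  move: h4; rewrite /flabels /= => h4; apply: lle_join; by rewrite -catA.
- rewrite -{1}(join_halves r1) act_split1.
  case: h5 => [h5|[-> -> h5]]; first by apply: (aux t1 [:: t0] (t2 :: ts)) => //=; rewrite r0 r2.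
  have /= -> := stl_rcons0 [:: t0; (halves t1).1; (halves t1).2].
  by apply: (aux t1 [:: t0] [::]) => //=; rewrite r0.
- rewrite act_merge0; exists [:: join t0 t1, t2 & ts]; split=> //=.
    by rewrite r2 rs reduced_join.
  move: h4; rewrite /flabels /= => h4; apply: (@lle_join t0 t1 _ [::]); by rewrite /= -catA.
- rewrite -{1}(join_halves r0) act_split0.
  case: h5 => [h5|[-> -> h5]]; first by apply: (aux t0 [::] [:: t1, t2 & ts]) => //=; rewrite r1 r2.
  have /= -> := stl_rcons0 [:: (halves t0).1; (halves t0).2; t1].
  by apply: (aux t0 [::] [:: t1]) => //=; rewrite r1.
Qed.

(** * The spanning tree *)

Lemma all_reduced_nth (ts : seq tree) (n : nat) : all reduced ts -> reduced (stl ts n).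
Proof.
move=> h; case: (ltnP n (size ts)) => sn; last by rewrite /stl nth_default.
exact: all_nthP.
Qed.

Lemma supported_reduced (s : state) (n : nat) : supported s -> reduced (s n).
Proof. by case=> m [ts [_ h -> _]]; apply: all_reduced_nth. Qed.

Lemma supported_act (a : letter) (s : state) : supported s -> supported (act a s).
Proof. by case=> n h; exists n.+1; exact: fits_act. Qed.

Lemma supported_acts (w : word) (s : state) : supported s -> supported (acts w s).
Proof. by elim: w s => //= a w IH s h; apply/IH/supported_act. Qed.

Lemma supported_st0 : supported st0.
Proof. by exists 2; exact: fits_st0. Qed.

Lemma supported_stl (ts : seq tree) : all reduced ts -> supported (stl ts).
Proof.
(* The number of leaves plus the sum of the labels bounds the reach of every caret. *)
move=> h; exists (size (flabels (ts ++ nseq 2 (Leaf 0))) + sumn (flabels (ts ++ nseq 2 (Leaf 0)))).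
exists (ts ++ nseq 2 (Leaf 0)); split.
- by rewrite size_cat /=; lia.
- by rewrite all_cat h.
- have -> : ts ++ nseq 2 (Leaf 0) = rcons (rcons ts (Leaf 0)) (Leaf 0) by rewrite -!cats1 -catA.
  by rewrite !stl_rcons0.
by elim: (flabels _) => //= a L IH; apply/andP; split; [lia|apply: fitting_leq IH; lia].
Qed.

Lemma act_linvK (a : letter) (s : state) : supported s -> act (linv a) (act a s) = s.
Proof.
move=> ts; have rs n := supported_reduced n ts.
case: a => -[] []; apply/funext => -[|[|[|n]]]; rewrite /act /= ?join_halves //;
by rewrite halves_join.
Qed.

Lemma supportedE (k : nat) (s : state) : supported s ->
  exists ts, [/\ size ts >= k, all reduced ts & s = stl ts].
Proof. by case=> n /(fits_pad k)[ts [h1 h2 h3 _]]; exists ts. Qed.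

(** [x0 x1^-1] regroups trees 0 and 1, whereas [x0^-1 x1 x0] splits tree 2 and [x0^-2 x1 x0^2]
    splits tree 3. They touch different trees and therefore commute. *)
Lemma acts_relator (i : bool) (s : state) : supported s -> acts (relator i) s = s.
Proof.
case/(supportedE 4) => -[|t0 [|t1 [|t2 [|t3 ts]]]] [] //= _ /and5P[r0 r1 r2 r3 _] ->.
have [t [l [_ _ ->]]] := joinP r0.
case: i; rewrite /relator /rel1 /rel2 /comm /acts /=.
- have [T1 [T2 [_ _ ->]]] := joinP r3.
  by do 14! rewrite ?(act_split0, act_split1, act_merge0, act_merge1).
have [T1 [T2 [_ _ ->]]] := joinP r2.
by do 10! rewrite ?(act_split0, act_split1, act_merge0, act_merge1).
Qed.

Definition least (P : nat -> Prop) : nat :=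
  if pselect (exists n, `[< P n >]) is left h then ex_minn h else 0.

Lemma leastP (P : nat -> Prop) : (exists n, P n) ->
  P (least P) /\ forall m, P m -> least P <= m.
Proof.
case=> n Pn; rewrite /least; case: pselect => [h|[]]; last by exists n; apply/asboolP.
by case: ex_minnP => m /asboolP Pm le; split=> // k /asboolP /le.
Qed.

Definition room (s : state) : nat := least (fits ^~ s).

Lemma fits_room (s : state) : supported s -> fits (room s) s.
Proof. by case/leastP. Qed.

Lemma room_le (n : nat) (s : state) : fits n s -> room s <= n.
Proof. by move=> h; have [_] := leastP (ex_intro (fits ^~ s) n h); apply. Qed.

Lemma room_act (a : letter) (s : state) : supported s -> room (act a s) <= (room s).+1.
Proof. by move/fits_room/(fits_act a)/room_le. Qed.

Lemma room_st0 : room st0 <= 2.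
Proof. exact: room_le fits_st0. Qed.

(* A caret can be removed with the cursor at r, T being the next tree: either the root caret
   of r, or a caret of P on two consecutive leaves. *)
Definition has_op (r T : tree) : bool := is_node r || cancels r T.

Fixpoint left_op (t T : tree) : bool :=
  if t is Node l r then has_op r T || left_op l r else false.

Lemma left_op_join (l r T : tree) : left_op (join l r) T = has_op r T || left_op l r.
Proof. by case: l => [[|a]|? ?]; case: r => [[|b]|? ?]. Qed.

Definition right_op (s : state) : Prop := exists j, 1 < j /\ has_op (s j) (s j.+1).

(* The letter that leads from s to its parent in the spanning tree: move the cursor to the
   leftmost removable caret and remove it. *)
Definition toward (s : state) : letter :=
  if left_op (s 0) (s 1) then (false, false)
  else if has_op (s 1) (s 2) then (true, ~~ is_node (s 1))
  else if `[< right_op s >] then (false, true)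
  else (false, ~~ is_node (s 0)).

Definition parent (s : state) : state := act (toward s) s.

Definition grounded (s : state) : Prop := exists n, iter n parent s = st0.

Lemma grounded_parent (s : state) : grounded (parent s) -> grounded s.
Proof. by case=> n h; exists n.+1; rewrite iterSr. Qed.

Fixpoint carets (t : tree) : nat :=
  match t with Leaf a => a | Node l r => (carets l + carets r).+1 end.
(** The left spine of tree 0 and the label at its foot are left out, since x_0-moves change them.
    What remains is invariant under these moves. *)
Fixpoint spine_carets (t : tree) : nat :=
  match t with Leaf _ => 0 | Node l r => spine_carets l + carets r end.
Definition fcarets (ts : seq tree) : nat := sumn (map carets ts).

Lemma spine_carets_join (l r : tree) :
  spine_carets (join l r) = spine_carets l + carets r.
Proof. by case: l => [[|a]|? ?]; case: r => [[|b]|? ?]. Qed.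

(** Proceed leftwards from the end of the list: in front of [Leaf 0], a node could be split and a
    nonzero leaf would cancel. *)
Lemma no_op_zero (ts : seq tree) :
  (forall j, 0 < j -> ~~ has_op (stl ts j) (stl ts j.+1)) ->
  forall j, 0 < j -> stl ts j = Leaf 0.
Proof.
move=> h; suff H k : forall j, 0 < j -> size ts <= j + k -> stl ts j = Leaf 0.
  by move=> j j0; apply: (H (size ts)) => //; lia.
elim: k => [|k IH] j j0 sz; first by rewrite /stl nth_default //; lia.
have e : stl ts j.+1 = Leaf 0 by apply: IH => //; lia.
by have := h j j0; rewrite e; case: (stl ts j) => [[]|].
Qed.

Lemma stl1 (t0 : tree) (s : state) : s 0 = t0 -> (forall j, 0 < j -> s j = Leaf 0) ->
  s = stl [:: t0].
Proof. by move=> h1 h2; apply/funext => -[|n] //; rewrite h2 // /stl; case: n. Qed.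

(** Only a power of x_0 is left, and [toward] walks home along x_0-edges. *)
Lemma grounded_no_op (t0 : tree) (ts : seq tree) : all reduced (t0 :: ts) ->
  ~~ left_op t0 (stl (t0 :: ts) 1) ->
  (forall j, 0 < j -> ~~ has_op (stl (t0 :: ts) j) (stl (t0 :: ts) j.+1)) ->
  grounded (stl (t0 :: ts)).
Proof.
elim: t0 ts => [a|l IHl r _] ts.
  move=> _ _ h; rewrite (@stl1 (Leaf a) (stl (Leaf a :: ts))) //; last exact: no_op_zero.
  elim: a {h} => [|a IH]; first by exists 0; apply/funext => -[|[|n]].
  apply: grounded_parent; rewrite /parent.
  have -> : toward (stl [:: Leaf a.+1]) = (false, true).
    rewrite /toward /=; case: asboolP => // -[[|[|j]]] [] //=; by case: j.
  have -> : stl [:: Leaf a.+1] = stl [:: Leaf a.+1; Leaf 0].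
    exact: esym (stl_rcons0 [:: _]).
  by rewrite act_merge0.
move=> rs nl h; apply: grounded_parent; rewrite /parent.
have -> : toward (stl (Node l r :: ts)) = (false, false).
  rewrite /toward (negbTE nl) (negbTE (h 1 _)) //.
  by case: asboolP => // -[j [j1]]; rewrite (negbTE (h j _)) //; lia.
move: rs => /=; case/andP => /and3P[rl rr nc] rts.
rewrite -(join_node nc) act_split0.
move: nl => /=; rewrite negb_or => /andP[n1 n2].
apply: IHl => //=; first by rewrite rl rr.
by case=> [//|[|j]] _; [exact: n1|exact: (h j.+1)].
Qed.

(** The measure counts the carets off the left spine. Removing one lowers it ([here]); cursor moves
    preserve it, and they end by induction on tree 0 when going left ([left]) and on the distance j
    when going right ([right]). *)
Lemma grounded_tame (s : state) : supported s -> grounded s.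
Proof.
case/(supportedE 1) => -[|t0 ts] [] // _ rs ->; move: rs.
have [k] := ubnP (spine_carets t0 + fcarets ts).
elim: k t0 ts => // k IH t0 ts hk rs.
pose s' (t0 : tree) ts := stl (t0 :: ts).
have here t1 us : spine_carets t1 + fcarets us < k.+1 -> all reduced (t1 :: us) ->
    ~~ left_op t1 (s' t1 us 1) -> has_op (s' t1 us 1) (s' t1 us 2) ->
    grounded (s' t1 us).
  case: us => // -[[//|b]|l r] us hk' rs' nl op; apply: grounded_parent;
    rewrite /parent /toward /s' (negbTE nl) op.
  - case: us op nl hk' rs' => [|[[]|] us] //= op nl hk' /andP[r1 r2].
      have -> : stl [:: t1; Leaf b.+1] = stl [:: t1; Leaf b.+1; Leaf 0].
        exact: esym (stl_rcons0 [:: _; _]).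
      by rewrite act_merge1; apply: IH => //=; rewrite ?r1 //; move: hk'; rewrite /fcarets /=; lia.
    by rewrite act_merge1; apply: IH => //=; rewrite ?r1 //; move: hk'; rewrite /fcarets /=; lia.
  move: rs' => /= /and3P[r1 /and3P[rl rr nc] rus].
  rewrite -(join_node nc) act_split1; apply: IH => /=; last by rewrite r1 rl rr.
  by move: hk'; rewrite /fcarets /=; lia.
have left t1 us : spine_carets t1 + fcarets us < k.+1 -> all reduced (t1 :: us) ->
    left_op t1 (s' t1 us 1) -> grounded (s' t1 us).
  elim: t1 us => // l IHl r _ us hk' rs' lop.
  apply: grounded_parent; rewrite /parent /toward lop.
  move: rs' => /=; case/andP => /and3P[rl rr nc] rus.
  rewrite /s' -(join_node nc) act_split0.
  have hk2 : spine_carets l + fcarets (r :: us) < k.+1.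
    by move: hk' => /=; rewrite /fcarets /=; lia.
  have rs2 : all reduced [:: l, r & us] by rewrite /= rl rr.
  case: (boolP (left_op l r)) => lop2; first exact: IHl.
  by apply: here => //; move: lop => /=; rewrite (negbTE lop2) orbF.
have right j t1 us : spine_carets t1 + fcarets us < k.+1 -> all reduced (t1 :: us) ->
    ~~ left_op t1 (s' t1 us 1) -> 0 < j -> has_op (s' t1 us j) (s' t1 us j.+1) ->
    grounded (s' t1 us).
  elim: j t1 us => // j IHj t1 us hk' rs' nl _ op.
  case: (boolP (has_op (s' t1 us 1) (s' t1 us 2))) => [|nop]; first exact: here.
  case: j IHj op => [|j] IHj op; first by rewrite op in nop.
  case: us hk' rs' nl op nop => [|t2 us] hk' rs' nl op nop; first by case: (j) op.
  apply: grounded_parent; rewrite /parent /toward (negbTE nl) (negbTE nop).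
  case: asboolP => [_|[]]; last by exists j.+2.
  rewrite /s' act_merge0; apply: IHj => //=.
  - by rewrite spine_carets_join; move: hk'; rewrite /fcarets /=; lia.
  - by move: rs' => /= /and3P[r1 r2 ->]; rewrite reduced_join.
  by rewrite /s' /= left_op_join negb_or nop.
case: (boolP (left_op t0 (s' t0 ts 1))) => [|nl]; first exact: left.
case: (pselect (exists j, 0 < j /\ has_op (s' t0 ts j) (s' t0 ts j.+1))) => [[j [j0 op]]|nop].
  exact: (right j).
by apply: grounded_no_op => // j j0; apply/negP => op; apply: nop; exists j.
Qed.

Lemma stl_cat (A us vs : seq tree) : stl us = stl vs -> stl (A ++ us) = stl (A ++ vs).
Proof.
move=> e; apply/funext => n; rewrite /stl !nth_cat; case: ifP => // _.
by move: e => /(congr1 (fun s : state => s (n - size A))).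
Qed.

Lemma fits_regroup (n : nat) (t : tree) (A us : seq tree) :
  fits n (stl (t :: us)) -> 0 < size A -> all reduced A ->
  lle (flabels A) (labels t) -> fits n (stl (A ++ us)).
Proof.
case=> -[|t' us'] [] //= sz /andP[rt rus] e ft sA rA le.
have et : t = t' := congr1 (fun s : state => s 0) e.
have eus : stl us = stl us'.
  apply/funext => m; exact: (congr1 (fun s : state => s m.+1) e).
exists (A ++ us'); split.
- by rewrite size_cat; lia.
- by rewrite all_cat rA.
- exact: stl_cat.
rewrite flabels_cat; apply: (le n [::]); rewrite et; exact: ft.
Qed.

Lemma lle_decr (a : nat) : lle [:: a] [:: a.+1].
Proof.
move=> n A; elim: A n => [|c A IH] n B /=.
  by case/andP => h1 ->; rewrite andbT; lia.
case/andP => h1 h2; rewrite (IH _ B) // andbT.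
move: h1; rewrite !sumn_cat /=; lia.
Qed.

(** [toward] splits only nodes, which keeps the list of leaves, and its merges can only cancel. *)
Lemma fits_parent (n : nat) (s : state) : s <> st0 -> fits n s -> fits n (parent s).
Proof.
move=> s0 [] [|t0 [|t1 us]] [] // _ rs es ft; rewrite /parent.
have split0 : is_node t0 -> fits n (act (false, false) s).
  move: rs ft; rewrite es; case: t0 {es} => // l r /= /and3P[/and3P[rl rr nc] r1 rus] ft _.
  rewrite -(join_node nc) act_split0; exists [:: l, r, t1 & us]; split=> //=.
    by rewrite rl rr r1.
  by move: ft; rewrite /flabels /= -catA.
rewrite /toward; case: ifP => [lop|nlop].
  by apply: split0; move: lop; rewrite es; case: (t0).
move: rs => /= /and3P[r0 r1 rus].
case: ifP => [op|nop].
  have [nd|nnd] := boolP (is_node (s 1)).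
    move: nd; rewrite es /=; case: t1 {es split0} r1 ft {op nlop} => //= l r /and3P[rl rr nc] ft _.
    rewrite -(join_node nc) act_split1; exists [:: t0, l, r & us]; split=> //=.
      by rewrite r0 rl rr.
    by move: ft; rewrite /flabels /= -catA.
  move: op nnd; rewrite es /=; case: t1 {split0 es nlop r1} ft => [[|b]|] //.
  case: us rus => [|[[|]|] us] //= rus ft _ _.
    have -> : stl [:: t0; Leaf b.+1] = stl [:: t0; Leaf b.+1; Leaf 0].
      exact: esym (stl_rcons0 [:: _; _]).
    rewrite act_merge1; exists [:: t0; Leaf b]; split=> //=; first by rewrite r0.
    by move: ft; rewrite /flabels /=; exact: lle_decr.
  rewrite act_merge1; exists [:: t0, Leaf b & us]; split=> //=; first by rewrite r0 rus.
  by move: ft; rewrite /flabels /=; exact: lle_cancel.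
(* The merge uses up one tree of the list, and two have to remain. *)
have merge0 : 0 < size us -> fits n (act (false, true) s).
  move=> sz; rewrite es act_merge0; exists (join t0 t1 :: us); split=> //=.
    by rewrite reduced_join.
  move: ft; rewrite /flabels /= catA.
  exact: (@lle_join t0 t1 n [::]).
case: asboolP => [[j [j1 op]]|nr].
  apply: merge0; move: op j1; rewrite es; case: (us) => // .
  by case: j => [|[|[|j]]].
have [nd|nnd] := boolP (is_node (s 0)); first by apply: split0; rewrite es in nd.
have [sz|] := boolP (0 < size us); first exact: merge0.
case: us {split0 merge0 rus} es ft => //= es ft _.
move: nop; rewrite es; case: t1 r1 es ft => [[|]|] //= _ es ft _.
move: nnd; rewrite es /=; case: t0 {r0 nlop} es ft => // -[|a] es ft _.
  by case: s0; rewrite es; apply/funext => -[|[|[]]].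
rewrite act_merge0 /=; exists [:: Leaf a; Leaf 0]; split=> //.
  exact: esym (stl_rcons0 [:: _]).
by move: ft; rewrite /flabels /=; lia.
Qed.

Lemma room_parent (s : state) : supported s -> s <> st0 -> room (parent s) <= room s.
Proof. by move=> ts s0; apply/room_le/fits_parent/fits_room. Qed.

(** * Word length bounded by the room *)

Definition costs (n : nat) (s : state) : Prop :=
  exists w, size w <= n /\ acts w s = st0.

Lemma costs_act (n : nat) (a : letter) (s : state) : costs n (act a s) -> costs n.+1 s.
Proof. by case=> w [h1 h2]; exists (a :: w). Qed.

Lemma costs_leq (m n : nat) (s : state) : m <= n -> costs m s -> costs n s.
Proof. by move=> mn [w [h1 h2]]; exists w; split=> //; lia. Qed.

Definition comb (a : nat) (bs : seq nat) : tree := foldl join (Leaf a) (map Leaf bs).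

Lemma comb_rcons (a b : nat) (bs : seq nat) : comb a (rcons bs b) = join (comb a bs) (Leaf b).
Proof. by rewrite /comb map_rcons foldl_rcons. Qed.

(* With Q trivial, undo the carets of P from right to left. *)
Lemma costs_comb (a b : nat) (bs : seq nat) :
  costs (a + sumn bs + b + size bs) (stl [:: comb a bs; Leaf b]).
Proof.
elim/last_ind: bs b => [|bs c IH] b; elim: b => [|b IHb].
- rewrite /comb /=; have -> : stl [:: Leaf a; Leaf 0] = stl [:: Leaf a] := stl_rcons0 [:: _].
  rewrite !addn0; elim: a => [|a IHa].
    by exists [::]; split=> //; apply/funext => -[|[]].
  apply: (@costs_act _ (false, true)).
  have -> : stl [:: Leaf a.+1] = stl [:: Leaf a.+1; Leaf 0] := esym (stl_rcons0 [:: _]).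
  by rewrite act_merge0.
- have -> : stl [:: comb a [::]; Leaf b.+1] = stl [:: comb a [::]; Leaf b.+1; Leaf 0].
    exact: esym (stl_rcons0 [:: _; _]).
  by rewrite addnS; apply: (@costs_act _ (true, true)); rewrite act_merge1.
- rewrite sumn_rcons size_rcons addnS; apply: (@costs_act _ (false, false)).
  rewrite comb_rcons act_split0.
  have -> : stl [:: comb a bs; Leaf c; Leaf 0] = stl [:: comb a bs; Leaf c] := stl_rcons0 [:: _; _].
  by apply: costs_leq (IH c); lia.
- have -> : stl [:: comb a (rcons bs c); Leaf b.+1] = stl [:: comb a (rcons bs c); Leaf b.+1; Leaf 0].
    exact: esym (stl_rcons0 [:: _; _]).
  by rewrite addnS; apply: (@costs_act _ (true, true)); rewrite act_merge1.
Qed.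

Fixpoint nodes (t : tree) : nat := if t is Node l r then (nodes l + nodes r).+1 else 0.
Definition fnodes (ts : seq tree) : nat := sumn (map nodes ts).

Lemma size_labels (t : tree) : size (labels t) = (nodes t).+1.
Proof. by elim: t => //= l hl r hr; rewrite size_cat hl hr; lia. Qed.

Lemma size_flabels (ts : seq tree) : size (flabels ts) = fnodes ts + size ts.
Proof.
elim: ts => //= t ts IH; rewrite size_cat size_labels IH /fnodes /=; lia.
Qed.

(* Undo the carets of Q from left to right: each leaf of Q is passed at most twice, once here
   and once in [costs_comb]. *)
Lemma costs_forest (a : nat) (bs : seq nat) (ts : seq tree) : all reduced ts ->
  costs (a + sumn bs + size bs + fnodes ts + 2 * size (flabels ts) + sumn (flabels ts))
        (stl (comb a bs :: ts)).
Proof.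
have [k] := ubnP (fnodes ts + size (flabels ts)).
elim: k bs ts => // k IH bs [|[b|l r] ts] hk rs.
- have -> : stl [:: comb a bs] = stl [:: comb a bs; Leaf 0] := esym (stl_rcons0 [:: _]).
  by apply: costs_leq (costs_comb _ _ _); rewrite /=; lia.
- apply: (@costs_leq (a + sumn (rcons bs b) + size (rcons bs b) + fnodes ts +
    2 * size (flabels ts) + sumn (flabels ts)).+1).
    rewrite sumn_rcons size_rcons /flabels /fnodes /=; lia.
  apply: (@costs_act _ (false, true)); rewrite act_merge0 -comb_rcons.
  by apply: IH => //; move: hk; rewrite /flabels /fnodes /=; lia.
move: rs => /= /andP[/and3P[rl rr nc] rus]; rewrite -(join_node nc).
apply: (@costs_leq (a + sumn bs + size bs + fnodes [:: l, r & ts] +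
    2 * size (flabels [:: l, r & ts]) + sumn (flabels [:: l, r & ts])).+1).
  by rewrite join_node // /flabels /fnodes /= -catA; lia.
apply: (@costs_act _ (true, false)); rewrite act_split1; apply: IH => /=.
  by move: hk; rewrite /flabels /fnodes /= -catA; lia.
by rewrite rl rr.
Qed.

(** Bring the cursor to the left end first, at one letter per caret on the left spine; then
    [costs_forest] applies. *)
Lemma costs_stl (t : tree) (ts : seq tree) : all reduced (t :: ts) ->
  costs (fnodes (t :: ts) + 2 * size (flabels (t :: ts)) + sumn (flabels (t :: ts)))
        (stl (t :: ts)).
Proof.
elim: t ts => [a|l IHl r _] ts rs.
  by apply: costs_leq (@costs_forest a [::] ts rs); rewrite /fnodes /flabels /=; lia.
move: rs => /= /andP[/and3P[rl rr nc] rus]; rewrite -(join_node nc).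
apply: (@costs_leq (fnodes [:: l, r & ts] + 2 * size (flabels [:: l, r & ts]) +
    sumn (flabels [:: l, r & ts])).+1).
  by rewrite join_node // /flabels /fnodes /= -catA; lia.
apply: (@costs_act _ (false, false)); rewrite act_split0; apply: IHl => /=.
by rewrite rl rr.
Qed.

Lemma costs_room (s : state) : supported s -> costs (4 * room s) s.
Proof.
move/fits_room; move: (room s) => n [] [|t ts] [] // _ rs -> ft.
apply: costs_leq (costs_stl rs).
(* The nodes, the leaves counted twice, and the labels contribute at most n, 2n and n. *)
by have := fitting_size ft; have := fitting_sumn ft; rewrite size_flabels; lia.
Qed.

(** * Normal forms read off the spanning tree *)

Definition depth (s : state) : nat := least (fun n => iter n parent s = st0).

Fixpoint undo_word (n : nat) (s : state) : word :=
  if n is m.+1 then rcons (undo_word m (parent s)) (linv (toward s)) else [::].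

Definition nform (s : state) : word := undo_word (depth s) s.

Lemma nform_st0 : nform st0 = [::].
Proof.
rewrite /nform; have [_ /(_ 0 erefl)] := leastP (grounded_tame supported_st0).
by rewrite -/(depth st0) leqn0 => /eqP ->.
Qed.

Lemma supported_parent (s : state) : supported s -> supported (parent s).
Proof. exact: supported_act. Qed.

(** [parent] does not fix [st0] but moves its cursor, which is why [depth] is the first time of
    arrival and [st0] is excluded. *)
Lemma depth_parent (s : state) : supported s -> s <> st0 ->
  depth s = (depth (parent s)).+1.
Proof.
move=> ts s0; have [h1 h2] := leastP (grounded_tame ts).
have [g1 g2] := leastP (grounded_tame (supported_parent ts)).
rewrite -!/(depth _) in h1 h2 g1 g2.
case: (depth s) h1 h2 => [|d] h1 h2; first by case: s0.
congr _.+1; apply/eqP; rewrite eqn_leq; apply/andP; split.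
  by have := h2 (depth (parent s)).+1; rewrite iterSr ltnS; apply.
by apply: g2; rewrite -iterSr.
Qed.

Lemma nform_parent (s : state) : supported s -> s <> st0 ->
  nform s = rcons (nform (parent s)) (linv (toward s)).
Proof. by move=> ts s0; rewrite /nform (depth_parent ts s0). Qed.

Lemma parent_ind (P : state -> Prop) : P st0 ->
  (forall s, supported s -> s <> st0 -> P (parent s) -> P s) ->
  forall s, supported s -> P s.
Proof.
move=> h0 h s ts; have [n] := grounded_tame ts.
elim: n s ts => [|n IH] s ts; first by move=> /= ->.
rewrite iterSr => e; case: (pselect (s = st0)) => [-> //|s0].
by apply: h => //; apply: IH => //; exact: supported_parent.
Qed.

Lemma acts_nform (s : state) : supported s -> acts (nform s) st0 = s.
Proof.
move: s; apply: parent_ind => [|s ts s0 IH]; first by rewrite nform_st0.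
by rewrite nform_parent // acts_rcons IH act_linvK.
Qed.

(** The prefixes of the normal form lead to the ancestors of s, and [room_parent] compares each of
    them with its parent. *)
Lemma room_nform (s : state) (j k : nat) : supported s -> j <= k ->
  room (acts (take j (nform s)) st0) <= room (acts (take k (nform s)) st0).
Proof.
move=> ts; move: s ts j k; apply: parent_ind => [|s ts s0 IH] j k jk.
  by rewrite nform_st0.
have tk m : m <= size (nform (parent s)) ->
    take m (nform s) = take m (nform (parent s)).
  by move=> h; rewrite nform_parent // -cats1 takel_cat.
have [kn|kn] := leqP k (size (nform (parent s))).
  by rewrite !tk //; [exact: IH|lia].
rewrite [take k _]take_oversize; last by rewrite nform_parent // size_rcons.
have [jn|jn] := leqP j (size (nform (parent s))); last first.
  by rewrite take_oversize // nform_parent // size_rcons.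
rewrite (tk j) // acts_nform //; apply: leq_trans (room_parent ts s0).
have := IH j _ jn; rewrite take_size acts_nform //; exact: supported_parent.
Qed.

(** * Induction along the 2-cells *)

(** [left_op t T] depends on T only through whether T is [Leaf 0]; [Leaf 1] stands for all the other
    trees. *)
Lemma left_op_leaf1 (t T : tree) : T <> Leaf 0 -> left_op t T = left_op t (Leaf 1).
Proof.
case: t => //= l r T0; congr (_ || _); case: r => [[|b]|? ?] //.
by case: T T0 => [[]|].
Qed.

Lemma supported_stl_ind (P : state -> Prop) :
  (forall l r ts, all reduced [:: l, r & ts] -> P (stl (join l r :: ts))) ->
  forall s, supported s -> P s.
Proof.
move=> h s /(supportedE 1)[[|t ts] [] // _ /= /andP[/joinP[l [r [rl rr ->]]] rts] ->].
by apply: h; rewrite /= rl rr.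
Qed.

Section Flow.

(** The property to be propagated, for the edge leaving a state by a letter. The room condition in
    [Ed_cell] is what keeps the filling of a cell from spoiling tameness. *)
Variable Ed : state -> letter -> Prop.

Hypothesis Ed_sym : forall s a, supported s -> Ed s a -> Ed (act a s) (linv a).
Hypothesis Ed_tree : forall s, supported s -> s <> st0 -> Ed s (toward s).
Hypothesis Ed_cell : forall s i k0, supported s -> k0 < size (relator i) ->
  (forall k, k < size (relator i) -> k != k0 ->
     Ed (acts (take k (relator i)) s) (nth (false, false) (relator i) k)) ->
  (forall k, k < size (relator i) -> room (acts (take k (relator i)) s) <=
     maxn (room (acts (take k0 (relator i)) s)) (room (acts (take k0.+1 (relator i)) s))) ->
  Ed (acts (take k0 (relator i)) s) (nth (false, false) (relator i) k0).

(** If a caret can be removed on the left, the end with the cursor further right crosses the edge;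
    if only on the right, the other end does. Without any such caret, the end farther from the
    identity crosses it on its way home. *)
Lemma Ed_x0 (e : bool) (s : state) : supported s -> Ed s (false, e).
Proof.
have main l r ts : all reduced [:: l, r & ts] -> Ed (stl (join l r :: ts)) (false, false).
  move=> rs; move: (rs) => /= /and3P[rl rr rts].
  have t1 : supported (stl [:: l, r & ts]) by exact: supported_stl.
  have t2 : supported (stl (join l r :: ts)).
    by apply: supported_stl; rewrite /= reduced_join.
  have tree1 : stl (join l r :: ts) <> st0 ->
      toward (stl (join l r :: ts)) = (false, false) ->
      Ed (stl (join l r :: ts)) (false, false).
    by move=> n0 <-; exact: Ed_tree.
  have tree2 : stl [:: l, r & ts] <> st0 ->
      toward (stl [:: l, r & ts]) = (false, true) ->
      Ed (stl (join l r :: ts)) (false, false).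
    move=> n0 e1; have := Ed_tree t1 n0; rewrite e1 => /(Ed_sym t1).
    by rewrite act_merge0.
  have [lop|nlop] := boolP (left_op (join l r) (stl ts 0)).
    apply: tree1; last by rewrite /toward [stl _ 0]/= lop.
    by move=> /(congr1 (fun s : state => s 0)) /= e0; rewrite e0 in lop.
  move: (nlop); rewrite left_op_join negb_or => /andP[nop nl].
  have [rop|nrop] := pselect (exists j, 0 < j /\ has_op (stl (join l r :: ts) j) (stl (join l r :: ts) j.+1)).
    apply: tree2.
      case: rop => -[|j] [] // _ op e1.
      move: op; have e2 k : nth (Leaf 0) ts k = Leaf 0 := congr1 (fun s : state => s k.+2) e1.
      by rewrite /stl /= !e2.
    rewrite /toward /= (negbTE nl) (negbTE nop).
    by case: asboolP => // -[]; case: rop => -[|j] [] // _ op; exists j.+2.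
  have ne j : 0 < j -> has_op (stl (join l r :: ts) j) (stl (join l r :: ts) j.+1) = false.
    by move=> j0; apply/negP => op; apply: nrop; exists j.
  have to1 : toward (stl (join l r :: ts)) = (false, ~~ is_node (join l r)).
    have := ne 1 isT; rewrite /toward /= (negbTE nlop) => ->; case: asboolP => // -[j [j1]].
    by rewrite ne //; lia.
  have to2 : toward (stl [:: l, r & ts]) = (false, ~~ is_node l).
    rewrite /toward /= (negbTE nl) (negbTE nop); case: asboolP => // -[[|[|j]] [j1]] //.
    by rewrite -[has_op _ _]/(has_op (stl (join l r :: ts) j.+1) (stl (join l r :: ts) j.+2)) ne.
  have [nd|nnd] := boolP (is_node (join l r)).
    apply: tree1; last by rewrite to1 nd.
    by move=> /(congr1 (fun s : state => s 0)) /= e0; rewrite e0 in nd.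
  have [a ea] : exists a, l = Leaf a.+1.
    by case: (l) (r) nnd => [[|a]|? ?] [[|b]|? ?] //= _; exists a.
  apply: tree2; last by rewrite to2 ea.
  by rewrite ea => /(congr1 (fun s : state => s 0)).
have {}main s' : supported s' -> Ed s' (false, false).
  by move: s'; exact: supported_stl_ind.
case: e => [ts|]; last exact: main.
have ts' := supported_act (false, true) ts.
rewrite -(act_linvK (false, true) ts); apply: (@Ed_sym _ (false, false)) => //.
exact: main.
Qed.

(* [Good t]: the x_1-edges are good at every state whose part on the left of the cursor is t. *)
Let Good (t : tree) : Prop := forall T1 T2 ts, all reduced [:: t, T1, T2 & ts] ->
  Ed (stl [:: t, join T1 T2 & ts]) (true, false).

(** The caret at the cursor is then the next one to be removed, so the edge lies in the tree. A
    caret of Q is removed by the split, a caret of P by the merge from the other end. *)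
Lemma Good_no_op (t : tree) : ~~ left_op t (Leaf 1) -> Good t.
Proof.
move=> nlop T1 T2 ts rs; move: (rs) => /= /and4P[rt r1 r2 rts].
have t1 : supported (stl [:: t, join T1 T2 & ts]).
  by apply: supported_stl; rewrite /= rt reduced_join.
have [nd|nnd] := boolP (is_node (join T1 T2)).
  have <- : toward (stl [:: t, join T1 T2 & ts]) = (true, false).
    rewrite /toward /= left_op_leaf1; last by case: (join T1 T2) nd.
    by rewrite (negbTE nlop) /has_op nd.
  apply: Ed_tree => // /(congr1 (fun s : state => s 1)) /= e.
  by rewrite e in nd.
have [a ea eb] : exists2 a, T1 = Leaf a.+1 & T2 = Leaf 0.
  by case: (T1) (T2) nnd => [[|a]|? ?] [[|b]|? ?] //= _; exists a.
have t2 : supported (stl [:: t, T1, T2 & ts]) by exact: supported_stl.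
rewrite -act_merge1; apply: (@Ed_sym _ (true, true)) => //.
have <- : toward (stl [:: t, T1, T2 & ts]) = (true, true).
  by rewrite /toward /= ea eb left_op_leaf1 // (negbTE nlop).
by apply: Ed_tree => //; rewrite ea => /(congr1 (fun s : state => s 1)).
Qed.

(** All these groupings have the leaves of t, l, r in the same order, up to cancellation in
    [join]. *)
Lemma lle_regroup (t l r : tree) (A : seq tree) :
  A = [:: join t l; r] \/ A = [:: t; l; r] \/ A = [:: t; join l r] \/
  A = [:: join t (join l r)] \/ A = [:: join (join t l) r] ->
  lle (flabels A) (labels t ++ labels l ++ labels r).
Proof.
have c (B : seq tree) x : flabels (rcons B x) = flabels B ++ labels x.
  by rewrite -cats1 flabels_cat /flabels /= cats0.
case=> [|[|[|[|]]]] ->; rewrite /flabels /= ?cats0 //.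
- by rewrite catA; apply: lle_cat => //; exact: lle_join.
- by apply: lle_cat => //; exact: lle_join.
- apply: lle_trans (@lle_join _ _) _; apply: lle_cat => //; exact: lle_join.
- rewrite catA; apply: lle_trans (@lle_join _ _) _; apply: lle_cat => //; exact: lle_join.
Qed.

Lemma room_regroup (t : tree) (A us : seq tree) (k : nat) : all reduced us ->
  reduced t -> 0 < size A -> all reduced A -> lle (flabels A) (labels t) ->
  room (stl (t :: us)) <= k -> room (stl (A ++ us)) <= k.
Proof.
move=> rus rt sA rA le h; apply: (leq_trans _ h); apply/room_le/(@fits_regroup _ t) => //.
by apply/fits_room/supported_stl; rewrite /= rt.
Qed.


(** [Ed_cell] with the vertices listed. [Ed_x0] supplies the x_0-sides, so only the four x_1-sides
    of a relator need attention. *)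
Lemma Ed_vertices (vs : seq state) (i : bool) (k0 : nat) (s0 := nth st0 vs 0) :
  size vs = size (relator i) -> supported s0 -> k0 < size vs ->
  (forall k, k.+1 < size vs ->
     act (nth (false, false) (relator i) k) (nth st0 vs k) = nth st0 vs k.+1) ->
  (forall k, k < size vs -> k != k0 -> (nth (false, false) (relator i) k).1 ->
     Ed (nth st0 vs k) (nth (false, false) (relator i) k)) ->
  (forall k, k < size vs -> room (nth st0 vs k) <=
     maxn (room (nth st0 vs k0)) (room (nth st0 vs k0.+1))) ->
  k0.+1 < size vs ->
  Ed (nth st0 vs k0) (nth (false, false) (relator i) k0).
Proof.
move=> sz ts k0s hact hEd hroom k1s.
have E k : k < size vs -> acts (take k (relator i)) s0 = nth st0 vs k.
  elim: k => [|k IH] ks; first by rewrite take0.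
  rewrite (take_nth (false, false)); last by rewrite -sz ltnW.
  by rewrite acts_rcons IH ?hact // ltnW.
have tk k : k < size vs -> supported (nth st0 vs k).
  by move=> /E <-; exact: supported_acts.
rewrite -(E k0) //; apply: Ed_cell => //; first by rewrite -sz.
- rewrite -sz => k ks kk0; rewrite E //.
  case e : (nth _ _ k) (hEd k ks kk0) => [[] x] /=; first by apply.
  by move=> _; apply: Ed_x0; exact: tk.
- by rewrite -sz => k ks; rewrite !E //; exact: hroom.
Qed.

(* Both cells commute a merge of l and r with an operation further right; V is the left part
   on the unknown side, and its labels are not cancelled so that no other vertex needs more
   room. *)
Lemma Good_cell0 (b : bool) (t l r : tree) :
  let M := join t (join l r) in let U := join (join t l) r in
  let V := if b then M else U in
  all reduced [:: t; l; r] -> labels V = labels t ++ labels l ++ labels r ->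
  Good t -> Good (if b then U else M) -> Good V.
Proof.
move=> M U V rs eV Gt GW T1 T2 ts rTs.
move: (rs) (rTs) => /= /and4P[rt rl rr _] /and4P[rV rT1 rT2 rts].
have rj := reduced_join.
have rT : reduced (join T1 T2) by exact: rj.
have rM : reduced M by rewrite /M ?rj.
have rU : reduced U by rewrite /U ?rj.
have tm (us : seq tree) : all reduced us -> supported (stl us) by exact: supported_stl.
have e1 : Ed (stl [:: t, l, r, join T1 T2 & ts]) (true, true).
  rewrite -(act_split1 t l r); apply: (@Ed_sym _ (true, false)).
    by apply: tm; rewrite /= rt rj // rT.
  by apply: Gt; rewrite /= rt rl rr rT.
have e2 : Ed (stl [:: t, join l r, T1, T2 & ts]) (true, false).
  by apply: Gt; rewrite /= rt rl rr rT1 rT2.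
have [m hm] : exists m, m = maxn (room (stl [:: V, join T1 T2 & ts])) (room (stl [:: V, T1, T2 & ts])).
  by eexists.
have rm (A : seq tree) : 0 < size A -> all reduced A ->
    lle (flabels A) (labels t ++ labels l ++ labels r) ->
    room (stl (A ++ join T1 T2 :: ts)) <= m /\ room (stl (A ++ [:: T1, T2 & ts])) <= m.
  by rewrite -eV => sA rA le; split; apply: (room_regroup _ rV) => //=;
    rewrite ?rT ?rT1 ?rT2 // hm ?leq_maxl ?leq_maxr.
have [|m1 m1'] := rm [:: join t l; r] isT _ (lle_regroup (or_introl erefl)).
  by rewrite /= rj // rr.
have [|m2 m2'] := rm [:: t; l; r] isT _ (lle_regroup (or_intror (or_introl erefl))).
  by rewrite /= rt rl rr.
have [|m3 m3'] := rm [:: t; join l r] isT _ (lle_regroup (or_intror (or_intror (or_introl erefl)))).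
  by rewrite /= rt rj.
have [|m4 m4'] := rm [:: M] isT _ (lle_regroup (or_intror (or_intror (or_intror (or_introl erefl))))).
  by rewrite /= rM.
have [|m5 m5'] := rm [:: U] isT _ (lle_regroup (or_intror (or_intror (or_intror (or_intror erefl))))).
  by rewrite /= rU.
(* The x_1-sides are numbers 1, 3, 5 and 8. Sides 1 and 5 have t on the left of the cursor, side 3
   has M and side 8 has U; side 8 is traversed by a merge. *)
pose vs := [:: stl [:: join t l, r, join T1 T2 & ts]; stl [:: t, l, r, join T1 T2 & ts];
  stl [:: t, join l r, join T1 T2 & ts]; stl [:: M, join T1 T2 & ts];
  stl [:: M, T1, T2 & ts]; stl [:: t, join l r, T1, T2 & ts];
  stl [:: t, l, r, T1, T2 & ts]; stl [:: join t l, r, T1, T2 & ts];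
  stl [:: U, T1, T2 & ts]; stl [:: U, join T1 T2 & ts]].
have vsact k : k.+1 < size vs ->
    act (nth (false, false) (relator false) k) (nth st0 vs k) = nth st0 vs k.+1.
  by move: k => -[|[|[|[|[|[|[|[|[|k]]]]]]]]] //=; rewrite ?(act_split0, act_split1, act_merge0, act_merge1).
have t0 : supported (nth st0 vs 0) by apply: tm; rewrite /= rj // rr rT.
move: GW rV eV hm rm m1 m1' m2 m2' m3 m3' m4 m4' m5 m5'; rewrite /V.
case: (b) => GW rV eV hm rm m1 m1' m2 m2' m3 m3' m4 m4' m5 m5'.
  apply: (@Ed_vertices vs false 3) => //.
  - move=> [|[|[|[|[|[|[|[|[|[|k]]]]]]]]]] //=; move=> _ _ _.
    rewrite -(act_split1 U T1 T2); apply: (@Ed_sym _ (true, false)).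
      by apply: tm; rewrite /= rU rT.
    by apply: GW; rewrite /= rU rT1 rT2.
  - by move=> [|[|[|[|[|[|[|[|[|[|k]]]]]]]]]] //=; rewrite -hm.
rewrite -(act_merge1 U T1 T2); apply: (@Ed_sym _ (true, true)).
  by apply: tm; rewrite /= rU rT1 rT2.
apply: (@Ed_vertices vs false 8) => //.
- move=> [|[|[|[|[|[|[|[|[|[|k]]]]]]]]]] //=; move=> _ _ _.
  by apply: GW; rewrite /= rM rT1 rT2.
- by move=> [|[|[|[|[|[|[|[|[|[|k]]]]]]]]]] //=; rewrite maxnC -hm.
Qed.

(** The second relator leaves one tree y between the merged pair and the cursor. *)
Lemma Good_cell1 (b : bool) (t l r y : tree) :
  let M := join (join t (join l r)) y in let U := join (join (join t l) r) y in
  let V := if b then M else U in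
  all reduced [:: t; l; r; y] ->
  labels V = (labels t ++ labels l ++ labels r) ++ labels y ->
  Good t -> Good (if b then U else M) -> Good V.
Proof.
move=> M U V rs eV Gt GW T1 T2 ts rTs.
move: (rs) (rTs) => /= /and5P[rt rl rr ry _] /and4P[rV rT1 rT2 rts].
have rj := reduced_join.
have rT : reduced (join T1 T2) by exact: rj.
pose M' := join t (join l r); pose U' := join (join t l) r.
have rM' : reduced M' by rewrite /M' ?rj.
have rU' : reduced U' by rewrite /U' ?rj.
have rM : reduced M by rewrite /M ?rj.
have rU : reduced U by rewrite /U ?rj.
have tm (us : seq tree) : all reduced us -> supported (stl us) by exact: supported_stl.
have e1 : Ed (stl [:: t, l, r, y, join T1 T2 & ts]) (true, true).
  rewrite -(act_split1 t l r); apply: (@Ed_sym _ (true, false)).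
    by apply: tm; rewrite /= rt rj // ry rT.
  by apply: Gt; rewrite /= rt rl rr ry rT.
have e2 : Ed (stl [:: t, join l r, y, T1, T2 & ts]) (true, false).
  by apply: Gt; rewrite /= rt rl rr ry rT1 rT2.
have [m hm] : exists m, m = maxn (room (stl [:: V, join T1 T2 & ts])) (room (stl [:: V, T1, T2 & ts])).
  by eexists.
have rm (A : seq tree) : 0 < size A -> all reduced A ->
    lle (flabels A) ((labels t ++ labels l ++ labels r) ++ labels y) ->
    room (stl (A ++ join T1 T2 :: ts)) <= m /\ room (stl (A ++ [:: T1, T2 & ts])) <= m.
  by rewrite -eV => sA rA le; split; apply: (room_regroup _ rV) => //=;
    rewrite ?rT ?rT1 ?rT2 // hm ?leq_maxl ?leq_maxr.
have rm' (A : seq tree) : 0 < size A -> all reduced A ->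
    lle (flabels A) (labels t ++ labels l ++ labels r) ->
    room (stl ((A ++ [:: y]) ++ join T1 T2 :: ts)) <= m /\ room (stl ((A ++ [:: y]) ++ [:: T1, T2 & ts])) <= m.
  move=> sA rA le; apply: rm; first by rewrite size_cat addn1.
    by rewrite all_cat rA /= ry.
  by rewrite flabels_cat {2}/flabels /= cats0; exact: lle_cat.
have [|m1 m1'] := rm' [:: join t l; r] isT _ (lle_regroup (or_introl erefl)).
  by rewrite /= rj // rr.
have [|m2 m2'] := rm' [:: t; l; r] isT _ (lle_regroup (or_intror (or_introl erefl))).
  by rewrite /= rt rl rr.
have [|m3 m3'] := rm' [:: t; join l r] isT _ (lle_regroup (or_intror (or_intror (or_introl erefl)))).
  by rewrite /= rt rj.
have l4 := lle_regroup (or_intror (or_intror (or_intror (or_introl (erefl [:: M']))))).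
have l5 := lle_regroup (or_intror (or_intror (or_intror (or_intror (erefl [:: U']))))).
have [|m4 m4'] := rm' [:: M'] isT _ l4; first by rewrite /= rM'.
have [|m5 m5'] := rm' [:: U'] isT _ l5; first by rewrite /= rU'.
have ly X : lle (flabels [:: X]) (labels t ++ labels l ++ labels r) ->
    lle (flabels [:: join X y]) ((labels t ++ labels l ++ labels r) ++ labels y).
  rewrite /flabels /= !cats0 => h; apply: lle_trans (@lle_join _ _) _.
  by apply: lle_cat.
have [|m6 m6'] := rm [:: M] isT _ (ly _ l4); first by rewrite /= rM.
have [|m7 m7'] := rm [:: U] isT _ (ly _ l5); first by rewrite /= rU.
(* Now the x_1-sides are 1, 4, 7 and 11, with t, M, t and U on the left of the cursor. *)
pose vs := [:: stl [:: join t l, r, y, join T1 T2 & ts]; stl [:: t, l, r, y, join T1 T2 & ts];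
  stl [:: t, join l r, y, join T1 T2 & ts]; stl [:: M', y, join T1 T2 & ts];
  stl [:: M, join T1 T2 & ts]; stl [:: M, T1, T2 & ts]; stl [:: M', y, T1, T2 & ts];
  stl [:: t, join l r, y, T1, T2 & ts];
  stl [:: t, l, r, y, T1, T2 & ts]; stl [:: join t l, r, y, T1, T2 & ts];
  stl [:: U', y, T1, T2 & ts]; stl [:: U, T1, T2 & ts]; stl [:: U, join T1 T2 & ts];
  stl [:: U', y, join T1 T2 & ts]].
have vsact k : k.+1 < size vs ->
    act (nth (false, false) (relator true) k) (nth st0 vs k) = nth st0 vs k.+1.
  by move: k => -[|[|[|[|[|[|[|[|[|[|[|[|[|k]]]]]]]]]]]]] //=; rewrite ?(act_split0, act_split1, act_merge0, act_merge1).
have t0 : supported (nth st0 vs 0) by apply: tm; rewrite /= rj // rr ry rT.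
move: GW rV eV hm rm rm' m1 m1' m2 m2' m3 m3' m4 m4' m5 m5' m6 m6' m7 m7'; rewrite /V.
case: (b) => GW rV eV hm rm rm' m1 m1' m2 m2' m3 m3' m4 m4' m5 m5' m6 m6' m7 m7'.
  apply: (@Ed_vertices vs true 4) => //.
  - move=> [|[|[|[|[|[|[|[|[|[|[|[|[|[|k]]]]]]]]]]]]]] //=; move=> _ _ _.
    rewrite -(act_split1 U T1 T2); apply: (@Ed_sym _ (true, false)).
      by apply: tm; rewrite /= rU rT.
    by apply: GW; rewrite /= rU rT1 rT2.
  - by move=> [|[|[|[|[|[|[|[|[|[|[|[|[|[|k]]]]]]]]]]]]]] //=; rewrite -hm.
rewrite -(act_merge1 U T1 T2); apply: (@Ed_sym _ (true, true)).
  by apply: tm; rewrite /= rU rT1 rT2.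
apply: (@Ed_vertices vs true 11) => //.
- move=> [|[|[|[|[|[|[|[|[|[|[|[|[|[|k]]]]]]]]]]]]]] //=; move=> _ _ _.
  by apply: GW; rewrite /= rM rT1 rT2.
- by move=> [|[|[|[|[|[|[|[|[|[|[|[|[|[|k]]]]]]]]]]]]]] //=; rewrite maxnC -hm.
Qed.

Let leaves (t : tree) : nat := size (labels t).

Lemma leaves_gt0 (t : tree) : 0 < leaves t.
Proof. by rewrite /leaves size_labels. Qed.

Lemma leaves_join (l r : tree) : leaves (join l r) <= leaves l + leaves r.
Proof.
by rewrite /leaves; case: l => [[|a]|? ?]; case: r => [[|b]|? ?] //=; rewrite ?size_cat.
Qed.

Lemma join_is_node (t x : tree) : is_node t -> join t x = Node t x.
Proof. by case: t. Qed.

Lemma is_node_foldl (A : tree) (post : seq tree) :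
  is_node A -> is_node (foldl Node A post).
Proof. by elim/last_ind: post => // p x IH; rewrite foldl_rcons. Qed.

(* If at least two trees separate the cursor from A, the first relator reduces the problem to
   the same one with the last two trees merged. *)
Lemma Good_post (N : nat) (A : tree) : is_node A ->
  (forall t, reduced t -> leaves t < N -> Good t) ->
  (forall post, size post <= 1 -> reduced (foldl Node A post) ->
     leaves (foldl Node A post) <= N -> Good (foldl Node A post)) ->
  forall post, reduced (foldl Node A post) -> leaves (foldl Node A post) <= N ->
    Good (foldl Node A post).
Proof.
move=> nA IHN H post; have [k] := ubnP (size post).
elim: k post => // k IH post; case/lastP: post => [_|post y]; first exact: H.
case/lastP: post => [_|post x]; first exact: H.
rewrite !size_rcons !foldl_rcons /= => hk /and3P[/and3P[rt rx nx] ry ny].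
rewrite /leaves /= !size_cat -!/(leaves _) => hN.
have nt : is_node (foldl Node A post) by exact: is_node_foldl.
have eU : join (join (foldl Node A post) x) y = Node (Node (foldl Node A post) x) y.
  by rewrite (join_is_node x nt).
rewrite -eU; apply: (@Good_cell0 false).
- by rewrite /= rt rx ry.
- by rewrite eU /= catA.
- by apply: IHN => //; have := leaves_gt0 x; lia.
have -> : join (foldl Node A post) (join x y) = foldl Node A (rcons post (join x y)).
  by rewrite foldl_rcons join_is_node.
apply: IH; rewrite ?size_rcons ?foldl_rcons //=.
- by rewrite rt reduced_join //; case: (foldl _ _ _) nt.
- by rewrite /leaves /= size_cat -!/(leaves _); have := leaves_join x y; lia.
Qed.

(** The trees on the left of the cursor are then single leaves, so only carets of P can be removed
    there. *)
Fixpoint flat (t : tree) : bool := if t is Node l r then ~~ is_node r && flat l else true.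

Lemma flat_join (t : tree) (b : nat) : flat t -> flat (join t (Leaf b)).
Proof. by case: t => [[|a]|? ?]; case: b. Qed.

(** A removable caret of P is a leaf [b.+1] followed by a leaf 0; the latter is either T itself or
    the next tree on the spine. *)
Lemma flat_left_op (t T : tree) : flat t -> left_op t T ->
  (exists t1 b, T = Leaf 0 /\ t = Node t1 (Leaf b.+1)) \/
  exists t1 b post, t = foldl Node (Node (Node t1 (Leaf b.+1)) (Leaf 0)) post.
Proof.
elim: t T => //= l IHl r _ T /andP[nr fl].
case/orP; first case: r nr => // b _.
  case: b => [|b] //; case: T => [[|c]|] // _.
  by left; exists l, b.
move/(IHl _ fl) => [[t1 [b [er el]]]|[t1 [b [post el]]]]; right.
  by exists t1, b, [::]; rewrite er el.
by exists t1, b, (rcons post r); rewrite foldl_rcons el.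
Qed.

(** Use the cancelling pair as l and r: on the opposite side of the cell it becomes the single leaf
    b, and that side has fewer leaves. *)
Lemma Good_flat (N : nat) (t : tree) :
  (forall t, reduced t -> leaves t < N -> Good t) ->
  flat t -> reduced t -> leaves t <= N -> Good t.
Proof.
move=> IHN ft rt hN; have [lop|] := boolP (left_op t (Leaf 1)); last exact: Good_no_op.
case: (flat_left_op ft lop) => [[t1 [b []]]//|[t1 [b [post et]]]].
rewrite et in rt hN *; apply: (Good_post _ IHN) => // {ft lop et post rt hN t}.
have e1 : join t1 (Leaf b.+1) = Node t1 (Leaf b.+1) by case: (t1) => // -[].
have small r : reduced t1 -> leaves t1 + r < N -> Good t1.
  by move=> rt hN; apply: IHN => //; lia.
case=> [|y [|]] //= _.
  move=> rA; have rt1 : reduced t1 by case: (reduced t1) rA.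
  rewrite /leaves /= !size_cat -/(leaves _) /= => hN.
  rewrite -[Node _ (Leaf 0)]/(join (Node t1 (Leaf b.+1)) (Leaf 0)) -e1.
  apply: (@Good_cell0 false).
  - by rewrite /= rt1.
  - by rewrite e1 /= -catA.
  - by apply: IHN => //; lia.
  apply: IHN; first by rewrite reduced_join.
  by have := leaves_join t1 (Leaf b); rewrite {3}/leaves /=; lia.
move=> rA; have rt1 : reduced t1 by case: (reduced t1) rA.
have ry : reduced y by case: (reduced y) rA; rewrite // andbF.
rewrite /leaves /= !size_cat -!/(leaves _) /= => hN.
rewrite -[Node _ y]/(join (join (Node t1 (Leaf b.+1)) (Leaf 0)) y) -e1.
apply: (@Good_cell1 false).
- by rewrite /= rt1 ry.
- by rewrite e1 /= -!catA.
- by apply: IHN => //; lia.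
apply: IHN; first by rewrite !reduced_join.
have := leaves_join (join t1 (Leaf b)) y.
by have := leaves_join t1 (Leaf b); rewrite {3}/leaves /=; lia.
Qed.

(* Remove the leftmost caret of Q: X is the leftmost tree that may have carets. Cancelling a
   caret of P lowers the number of leaves instead, which is the outer induction (IHN). *)
Lemma Good_forest (N q : nat) (X t : tree) (post : seq tree) :
  (forall t, reduced t -> leaves t < N -> Good t) ->
  leaves X + sumn (map leaves post) <= q ->
  flat t -> reduced t -> reduced X -> all reduced post ->
  leaves t + leaves X + sumn (map leaves post) <= N ->
  Good (foldl join (join t X) post).
Proof.
move=> IHN; elim: q X t post => [|q IHq] X; first by move=> ? ?; have := leaves_gt0 X; lia.
elim: X => [b|l IHl r _] t post hq ft rt rX rp hN.
  (* A leaf X is absorbed into the flat part and the next tree of [post] becomes X; q drops because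
     X had a leaf. *)
  have ft' := flat_join b ft; have rt' : reduced (join t (Leaf b)) by exact: reduced_join.
  have lt' := leaves_join t (Leaf b).
  case: post hq rp hN => [|Y post] /= hq rp hN; first by apply: (Good_flat IHN) => //; lia.
  move: rp => /andP[rY rp]; apply: IHq => //; last by lia.
move: rX => /= /and3P[rl rr nc].
have -> : join t (Node l r) = Node t (Node l r) by case: (t) => // -[].
have -> : foldl join (Node t (Node l r)) post = foldl Node (Node t (Node l r)) post.
  elim/last_ind: (post) => // p x IH; rewrite !foldl_rcons IH join_is_node //.
  exact: is_node_foldl.
have e1 : join t (join l r) = Node t (Node l r).
  by rewrite (join_node nc); case: (t) => // -[].
have lv : leaves (Node l r) = leaves l + leaves r by rewrite /leaves /= size_cat.
have lp p : leaves (foldl Node (Node t (Node l r)) p) =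
    leaves t + leaves (Node l r) + sumn (map leaves p).
  elim/last_ind: p => [|p x IH]; first by rewrite /leaves /= !size_cat; lia.
  rewrite foldl_rcons map_rcons sumn_rcons {1}/leaves /= size_cat -!/(leaves _) IH; lia.
have rp' p : all reduced p -> reduced (foldl Node (Node t (Node l r)) p).
  elim/last_ind: p => [|p x IH].
    by rewrite /= rt rl rr nc; case: (t) => // -[].
  rewrite all_rcons foldl_rcons /= => /andP[-> /IH ->].
  by have : is_node (foldl Node (Node t (Node l r)) p) by [exact: is_node_foldl]; case: (foldl _ _ _).
have gl := leaves_gt0 l; have gr := leaves_gt0 r; have gt := leaves_gt0 t.
have gX := leaves_gt0 (Node l r).
apply: (@Good_post (leaves (foldl Node (Node t (Node l r)) post))) => //; last exact: rp'.
  by move=> u ru hu; apply: IHN => //; move: hu; rewrite lp; lia.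
case=> [|y [|]] //= _ rA; rewrite ?lp => hA; rewrite -e1.
  (* On the opposite side the root caret of X is gone: l takes the place of X and r is put in front
     of [post]. *)
  apply: (@Good_cell0 true).
  - by rewrite /= rt rl rr.
  - by rewrite e1.
  - by apply: IHN => //; lia.
  by apply: (IHl t [:: r]) => //=; rewrite ?rr //; lia.
have ry : reduced y by case/and3P: rA.
move: hA; rewrite (lp [:: y]) /= => hA.
rewrite -(@join_is_node _ y); last by rewrite e1.
apply: (@Good_cell1 true).
- by rewrite /= rt rl rr ry.
- by rewrite e1 /= -!catA.
- by apply: IHN => //; lia.
by apply: (IHl t [:: r; y]) => //=; rewrite ?rr ?ry //; lia.
Qed.

Lemma reduced_spine (t : tree) : reduced t -> exists a post,
  [/\ all reduced post, t = foldl join (Leaf a) post &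
      leaves t = 1 + sumn (map leaves post)].
Proof.
elim: t => [a _|l IHl r _ /= /and3P[/IHl[a [post [rp el hl]]] rr nc]].
  by exists a, [::].
exists a, (rcons post r); rewrite all_rcons rr rp foldl_rcons -el join_node //; split=> //.
have -> : leaves (Node l r) = leaves l + leaves r by rewrite /leaves /= size_cat.
by rewrite hl map_rcons sumn_rcons; lia.
Qed.

Lemma Good_all (t : tree) : reduced t -> Good t.
Proof.
have [N] := ubnP (leaves t); elim: N t => // N IH t hN rt.
have [a [[|X post] [rp et ht]]] := reduced_spine rt.
  by apply: Good_no_op; rewrite et.
move: rp => /= /andP[rX rp]; rewrite et.
apply: (@Good_forest N (leaves X + sumn (map leaves post)) X (Leaf a) post) => //.
  by move=> u ru hu; apply: IH.
by have : leaves (Leaf a) = 1 by []; move: ht => /=; lia.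
Qed.

Lemma flow_ind (s : state) (a : letter) : supported s -> Ed s a.
Proof.
have x1 u : supported u -> Ed u (true, false).
  case/(supportedE 2) => -[|t [|T ts]] [] //= _ /and3P[rt rT rts] ->.
  have [T1 [T2 [r1 r2 ->]]] := joinP rT.
  by apply: Good_all => //=; rewrite rt r1 r2.
case: a => -[] e ts; last exact: Ed_x0.
case: e; last exact: x1.
have ts' := supported_act (true, true) ts.
by rewrite -(act_linvK (true, true) ts); apply: (@Ed_sym _ (true, false)) => //; exact: x1.
Qed.

End Flow.

(** * The group *)

Lemma wequiv_refl (w : word) : wequiv w w. Proof. exact: rst_refl. Qed.

Lemma wequiv_sym (u v : word) : wequiv u v -> wequiv v u.
Proof. exact: rst_sym. Qed.

Lemma wequiv_trans (v u w : word) : wequiv u v -> wequiv v w -> wequiv u w.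
Proof. exact: rst_trans. Qed.

Lemma wequiv_ctx (u v w w' : word) : wequiv w w' -> wequiv (u ++ w ++ v) (u ++ w' ++ v).
Proof.
elim=> {w w'} [w w' h|w|w w' _|w1 w2 w3 _ h1 _ h2].
- apply: rst_step; case: h => [u' v' a|u' v' i].
    by have := wstep_free (u ++ u') (v' ++ v) a; rewrite -!catA.
  by have := wstep_rel (u ++ u') (v' ++ v) i; rewrite -!catA.
- exact: rst_refl.
- exact: rst_sym.
- exact: rst_trans h1 h2.
Qed.

Lemma wequiv_catl (u w w' : word) : wequiv w w' -> wequiv (u ++ w) (u ++ w').
Proof. by move/(wequiv_ctx u [::]); rewrite !cats0. Qed.

Lemma wequiv_catr (v w w' : word) : wequiv w w' -> wequiv (w ++ v) (w' ++ v).
Proof. exact: (@wequiv_ctx [::]). Qed.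

Lemma wequiv_free (u v : word) (a : letter) : wequiv (u ++ [:: a; linv a] ++ v) (u ++ v).
Proof. exact/rst_step/wstep_free. Qed.

Lemma wequiv_relator (u v : word) (i : bool) : wequiv (u ++ relator i ++ v) (u ++ v).
Proof. exact/rst_step/wstep_rel. Qed.

Lemma winv_rcons (w : word) (a : letter) : winv (rcons w a) = linv a :: winv w.
Proof. by rewrite /winv map_rcons rev_rcons. Qed.

Lemma wequiv_winvr (w : word) : wequiv (w ++ winv w) [::].
Proof.
elim/last_ind: w => [|w a IH]; first exact: wequiv_refl.
rewrite winv_rcons -cats1 -catA; apply: wequiv_trans IH; exact: wequiv_free.
Qed.

Lemma wequiv_cancelr (u v w : word) : wequiv (u ++ w) (v ++ w) -> wequiv u v.
Proof.
move/(wequiv_catr (winv w)); rewrite -!catA => h.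
have e x : wequiv (x ++ w ++ winv w) x.
  by have := wequiv_catl x (wequiv_winvr w); rewrite cats0.
exact: wequiv_trans (wequiv_sym (e u)) (wequiv_trans h (e v)).
Qed.

Lemma wequiv_acts (u v : word) (s : state) : supported s -> wequiv u v -> acts u s = acts v s.
Proof.
move=> ts; elim=> {u v} [_ _ [u v a|u v i]|//|u v _ -> //|u v w _ -> _ -> //].
  by rewrite !acts_cat /= act_linvK //; exact: supported_acts.
by rewrite !acts_cat acts_relator //; exact: supported_acts.
Qed.

Lemma cls_eqP (u v : word) : cls u = cls v <-> wequiv u v.
Proof.
split=> [/(congr1 (@proj1_sig _ _)) /= e|h].
  by rewrite e; exact: wequiv_refl.
have e : wequiv u = wequiv v.
  apply/funext => w; apply/propext; split=> h'.
    exact: wequiv_trans (wequiv_sym h) h'.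
  exact: wequiv_trans h h'.
by apply: eq_exist.
Qed.

Lemma gmul_cls (u v : word) : gmul (cls u) v = cls (u ++ v).
Proof. by apply/cls_eqP/wequiv_catr/cls_eqP; rewrite clsK. Qed.

Lemma gmul_cat (g : G) (u v : word) : gmul (gmul g u) v = gmul g (u ++ v).
Proof. by rewrite -(clsK g) !gmul_cls catA. Qed.

Lemma gmul_nil (g : G) : gmul g [::] = g.
Proof. by rewrite -(clsK g) gmul_cls cats0. Qed.

Lemma gmul_linvK (g : G) (a : letter) : gmul (gmul g [:: a]) [:: linv a] = g.
Proof.
rewrite gmul_cat -{2}(clsK g) -{1}(clsK g) gmul_cls; apply/cls_eqP.
by have := wequiv_free (Defs.repr g) [::] a; rewrite !cats0.
Qed.

Lemma gmul_relator (g : G) (i : bool) : gmul g (relator i) = g.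
Proof.
rewrite -(clsK g) gmul_cls; apply/cls_eqP.
by have := wequiv_relator (Defs.repr g) [::] i; rewrite !cats0.
Qed.

Definition gst (g : G) : state := acts (Defs.repr g) st0.

Lemma gst_cls (w : word) : gst (cls w) = acts w st0.
Proof. by apply: wequiv_acts; [exact: supported_st0|apply/cls_eqP; rewrite clsK]. Qed.

Lemma gst_gmul (g : G) (w : word) : gst (gmul g w) = acts w (gst g).
Proof. by rewrite /gmul gst_cls acts_cat. Qed.

Lemma gst_eps : gst eps = st0.
Proof. exact: gst_cls. Qed.

Lemma supported_gst (g : G) : supported (gst g).
Proof. exact/supported_acts/supported_st0. Qed.

(** First use of [flow_ind]. On tree edges this is free cancellation. In a cell, [up] and [down]
    follow the boundary from the base to the two ends of the missing side, and one relator closes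
    the loop. *)
Lemma nform_act (s : state) (a : letter) : supported s ->
  wequiv (nform (act a s)) (rcons (nform s) a).
Proof.
move: s a; apply: flow_ind => [s a ts h|s ts s0|s i k0 ts k0s h _].
- rewrite act_linvK // -cats1; apply: wequiv_sym.
  apply: wequiv_trans (wequiv_catr [:: linv a] h) _.
  rewrite -cats1 -catA; have := wequiv_free (nform s) [::] a; by rewrite !cats0.
- rewrite (nform_parent ts s0); set p := nform (parent s).
  apply: wequiv_sym; rewrite -!cats1 -catA.
  have := wequiv_free p [::] (linv (toward s)); by rewrite linvK !cats0.
set r := relator i in k0s h *; pose v k := nform (acts (take k r) s).
have step k : k < size r -> k != k0 -> wequiv (v k.+1) (rcons (v k) (nth (false, false) r k)).
  by move=> kr /(h k kr); rewrite /v (take_nth (false, false) kr) acts_rcons.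
rewrite -acts_rcons -take_nth // -/(v k0) -/(v k0.+1).
have up k : k <= k0 -> wequiv (v k) (v 0 ++ take k r).
  elim: k => [|k IH] kk; first by rewrite take0 cats0; exact: wequiv_refl.
  have kr : k < size r by apply: leq_trans k0s; exact: ltnW.
  apply: wequiv_trans (step k kr _) _; first by rewrite ltn_eqF.
  rewrite (take_nth (false, false) kr).
  by rewrite -rcons_cat -!cats1; apply/wequiv_catr/IH/ltnW.
have down k : k0 < k -> k <= size r -> wequiv (v k ++ drop k r) (v (size r)).
  move=> k0k kr; have [d] := ubnP (size r - k); elim: d k k0k kr => // d IH k k0k kr hd.
  have [kr'|kr'] := ltnP k (size r); last first.
    have -> : k = size r by lia.
    by rewrite drop_size cats0; exact: wequiv_refl.
  rewrite (drop_nth (false, false) kr') -cat_rcons.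
  apply: wequiv_trans (IH k.+1 _ _ _); [|lia..].
  by apply/wequiv_catr/wequiv_sym/step => //; lia.
have v0 : v 0 = v (size r) by rewrite /v take0 take_size acts_relator.
apply: (@wequiv_cancelr _ _ (drop k0.+1 r)).
apply: wequiv_trans (down k0.+1 _ _) _ => //; rewrite -v0.
apply: wequiv_sym; rewrite -cats1.
apply: wequiv_trans (wequiv_catr _ (wequiv_catr _ (up k0 (leqnn _)))) _.
have -> : ((v 0 ++ take k0 r) ++ [:: nth (false, false) r k0]) ++ drop k0.+1 r = v 0 ++ r.
  by rewrite -!catA /= -drop_nth // cat_take_drop.
by have := wequiv_relator (v 0) [::] i; rewrite !cats0.
Qed.

Lemma cls_nform (g : G) : cls (nform (gst g)) = g.
Proof.
rewrite -{2}(clsK g) /gst; apply/cls_eqP.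
elim/last_ind: (Defs.repr g) => [|w a IH]; first by rewrite nform_st0; exact: wequiv_refl.
rewrite acts_rcons; apply: wequiv_trans (nform_act _ _) _.
  exact/supported_acts/supported_st0.
by rewrite -!cats1; apply: wequiv_catr.
Qed.

Lemma gst_inj : injective gst.
Proof. by move=> g h e; rewrite -(cls_nform g) e cls_nform. Qed.

Lemma wlen_le (w : word) (g : G) : cls w = g -> wlen g <= size w.
Proof.
by move=> e; rewrite /wlen; case: ex_minnP => n _; apply; apply/asboolP; exists w.
Qed.

Lemma wlen_word (g : G) : exists2 w, size w = wlen g & cls w = g.
Proof.
by rewrite /wlen; case: ex_minnP => n /asboolP[w [<- e]] _; exists w.
Qed.

Lemma wlen_gmul1 (g : G) (a : letter) : wlen (gmul g [:: a]) <= (wlen g).+1.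
Proof.
have [w sw e] := wlen_word g; rewrite -sw -e gmul_cls.
by apply: leq_trans (wlen_le erefl) _; rewrite size_cat addn1.
Qed.

Lemma wlen_gmul1r (g : G) (a : letter) : wlen g <= (wlen (gmul g [:: a])).+1.
Proof. by have := wlen_gmul1 (gmul g [:: a]) (linv a); rewrite gmul_linvK. Qed.

Definition groom (g : G) : nat := room (gst g).

Lemma groom_wlen (g : G) : groom g <= wlen g + 2.
Proof.
have [w <- <-] := wlen_word g; rewrite /groom gst_cls.
elim/last_ind: w => [|w a IH]; first exact: room_st0.
rewrite acts_rcons size_rcons addSn.
apply: leq_trans (room_act _ _) _; last by rewrite ltnS.
exact/supported_acts/supported_st0.
Qed.

Lemma wlen_groom (g : G) : wlen g <= 4 * groom g.
Proof.
have [w [sw aw]] := costs_room (supported_gst g).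
apply: leq_trans sw.
have e : gmul g w = eps by apply: gst_inj; rewrite gst_gmul aw gst_eps.
suff : wlen g <= size (winv w) by rewrite /winv size_rev size_map.
apply: wlen_le; rewrite -[winv w]cat0s -gmul_cls -/eps -e gmul_cat -{1}(clsK g) gmul_cls.
rewrite -[RHS](clsK g); apply/cls_eqP.
by have := wequiv_catl (Defs.repr g) (wequiv_winvr w); rewrite cats0.
Qed.

Local Open Scope classical_set_scope.
Local Open Scope ring_scope.

(** * Topology of the complex *)

(* A head symbol for continuity, so that [prove_cont] can match on the syntax of f. *)
Definition ctn (T U : topologicalType) (f : T -> U) : Prop := continuous f.

Lemma ctnW (T U : topologicalType) (f : T -> U) : ctn f -> continuous f.
Proof. by []. Qed.

Lemma ctn_cst (T U : topologicalType) (c : U) : ctn (fun _ : T => c).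
Proof. by move=> x; exact: cvg_cst. Qed.

Lemma ctn_id (T : topologicalType) : ctn (fun x : T => x).
Proof. by move=> x; exact: cvg_id. Qed.

Lemma ctn_fst (T U : topologicalType) : ctn (fun x : T * U => x.1).
Proof. by move=> x; exact: cvg_fst. Qed.

Lemma ctn_snd (T U : topologicalType) : ctn (fun x : T * U => x.2).
Proof. by move=> x; exact: cvg_snd. Qed.

Lemma ctn_pair (T U V : topologicalType) (f : T -> U) (g : T -> V) :
  ctn f -> ctn g -> ctn (fun x => (f x, g x)).
Proof. by move=> cf cg x; exact: (cvg_pair (cf x) (cg x)). Qed.

Lemma ctn_comp (T U V : topologicalType) (f : T -> U) (g : U -> V) :
  ctn f -> ctn g -> ctn (fun x => g (f x)).
Proof. by move=> cf cg x; exact: (continuous_comp (cf x) (cg (f x))). Qed.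

Lemma ctn_add (K : realType) (T : topologicalType) (f g : T -> K) :
  ctn f -> ctn g -> ctn (fun x => f x + g x).
Proof. by move=> cf cg x; apply: cvgD; [exact: cf|exact: cg]. Qed.

Lemma ctn_opp (K : realType) (T : topologicalType) (f : T -> K) :
  ctn f -> ctn (fun x => - f x).
Proof. by move=> cf x; apply: cvgN; exact: cf. Qed.

Lemma ctn_mul (K : realType) (T : topologicalType) (f g : T -> K) :
  ctn f -> ctn g -> ctn (fun x => f x * g x).
Proof. by move=> cf cg x; apply: cvgM; [exact: cf|exact: cg]. Qed.

Lemma ctn_min (K : realType) (T : topologicalType) (f g : T -> K) :
  ctn f -> ctn g -> ctn (fun x => Num.min (f x) (g x)).
Proof. by move=> cf cg x; exact: (@continuous_min K T f g x (cf x) (cg x)). Qed.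

Lemma ctn_max (K : realType) (T : topologicalType) (f g : T -> K) :
  ctn f -> ctn g -> ctn (fun x => Num.max (f x) (g x)).
Proof. by move=> cf cg x; exact: (@continuous_max K T f g x (cf x) (cg x)). Qed.

Ltac ctn_rec := lazymatch goal with
  | |- ctn (fun _ => ?c) => exact: ctn_cst
  | |- ctn (fun x => x) => exact: ctn_id
  | |- ctn (fun x => (x).1) => exact: ctn_fst
  | |- ctn (fun x => (x).2) => exact: ctn_snd
  | |- ctn (fun x => (@?f x, @?g x)) => refine (@ctn_pair _ _ _ f g _ _); ctn_rec
  | |- ctn (fun x => @?f x + @?g x) => refine (@ctn_add R _ f g _ _); ctn_rec
  | |- ctn (fun x => - @?f x) => refine (@ctn_opp R _ f _); ctn_rec
  | |- ctn (fun x => @?f x * @?g x) => refine (@ctn_mul R _ f g _ _); ctn_rec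
  | |- ctn (fun x => Num.min (@?f x) (@?g x)) => refine (@ctn_min R _ f g _ _); ctn_rec
  | |- ctn (fun x => Num.max (@?f x) (@?g x)) => refine (@ctn_max R _ f g _ _); ctn_rec
  end.

Ltac prove_cont := refine (ctnW _); rewrite /=; ctn_rec.

Lemma near_lt (K : realType) (T : topologicalType) (f : T -> K) (x : T) (c : K) :
  {for x, continuous f} -> f x < c -> \forall y \near x, f y < c.
Proof. by move=> cf ux; apply: (cf [set y | y < c]); exact: lt_nbhsl. Qed.

Lemma near_gt (K : realType) (T : topologicalType) (f : T -> K) (x : T) (c : K) :
  {for x, continuous f} -> c < f x -> \forall y \near x, c < f y.
Proof. by move=> cf ux; apply: (cf [set y | c < y]); exact: lt_nbhsr. Qed.

Lemma near_and (T : topologicalType) (x : T) (P Q : T -> Prop) :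
  (\forall y \near x, P y) -> (\forall y \near x, Q y) -> \forall y \near x, P y /\ Q y.
Proof. exact: filterI. Qed.

Lemma near_sub (T : topologicalType) (x : T) (P Q : T -> Prop) :
  (forall y, P y -> Q y) -> (\forall y \near x, P y) -> \forall y \near x, Q y.
Proof. by move=> PQ; exact: filterS. Qed.

(** The tube lemma. *)
Lemma near_tube (T U : topologicalType) (K : set T) (x : U) (P : U -> T -> Prop) :
  compact K -> (forall s, K s -> \forall z \near (s, x), P z.2 z.1) ->
  \forall y \near x, forall s, K s -> P y s.
Proof.
move=> /compact_near_coveringP cK h; apply: (cK U (nbhs x) P) => s /h [[A B] [/= nA nB] AB].
by exists (A, B) => // -[s' y] /= [As By]; exact: (AB (s', y)).
Qed.

Lemma relopen_comp (T U : topologicalType) (D : set T) (D' : set U) (f : T -> U) (S : set U) :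
  (forall x, D x -> D' (f x)) -> (forall x, D x -> {for x, continuous f}) ->
  relopen D' S -> relopen D (f @^-1` S).
Proof.
move=> fD cf oS x Dx Sx; have h : \forall y \near x, D' (f y) -> S (f y) := cf x Dx _ (oS _ (fD x Dx) Sx).
by apply: filterS h => y h Dy; apply/h/fD.
Qed.

(** The pasting lemma for the two closed parts into which the level set [u = c] divides D. *)
Lemma relopen_split (T : topologicalType) (D S : set T) (u : T -> R) (c : R) :
  continuous u ->
  relopen (D `&` [set x | u x <= c]) S -> relopen (D `&` [set x | c <= u x]) S ->
  relopen D S.
Proof.
move=> cu h1 h2 x Dx Sx.
have away1 : u x < c -> \forall y \near x, u y < c.
  exact: (@near_lt R _ u x c (cu x)).
have away2 : c < u x -> \forall y \near x, c < u y.
  exact: (@near_gt R _ u x c (cu x)).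
have [ux|ux|ux] := ltgtP (u x) c.
- have g := h1 x (conj Dx (ltW ux)) Sx; have a := away1 ux.
  by apply: filterS2 g a => y gy ay Dy; apply: gy; split=> //; exact: ltW.
- have g := h2 x (conj Dx (ltW ux)) Sx; have a := away2 ux.
  by apply: filterS2 g a => y gy ay Dy; apply: gy; split=> //; exact: ltW.
have xl : u x <= c by rewrite ux.
have xr : c <= u x by rewrite ux.
apply: filterS2 (h1 x (conj Dx xl) Sx) (h2 x (conj Dx xr) Sx) => y g1 g2 Dy.
by case: (lerP (u y) c) => [yc|/ltW yc]; [apply: g1|apply: g2]; split.
Qed.

Lemma relopen_ext (T : topologicalType) (D S S' : set T) :
  (forall x, D x -> S x <-> S' x) -> relopen D S -> relopen D S'.
Proof.
move=> e o x Dx S'x; apply: filterS (o x Dx (proj2 (e x Dx) S'x)) => y h Dy.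
by apply/(e y Dy)/h.
Qed.

Lemma relopen_sub (T : topologicalType) (D D' S : set T) :
  D' `<=` D -> relopen D S -> relopen D' S.
Proof.
by move=> dd o x D'x Sx; apply: filterS (o x (dd _ D'x) Sx) => y h /dd /h.
Qed.

Definition traverse (g : G) (a : letter) (u : R) : pt :=
  if a.2 then edge_map (gmul g [:: a]) a.1 (1 - u) else edge_map g a.1 u.

Lemma edge_map0 (g : G) (j : bool) : edge_map g j 0 = PV g.
Proof. by rewrite /edge_map lexx. Qed.

Lemma edge_map1 (g : G) (j : bool) : edge_map g j 1 = PV (gmul g [:: (j, false)]).
Proof. by rewrite /edge_map leNgt ltr01 lexx. Qed.

Lemma edge_mapE (g : G) (j : bool) (t : R) : 0 < t < 1 -> edge_map g j t = mkE g j t.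
Proof. by move=> /andP[t0 t1]; rewrite /edge_map !leNgt t0 t1. Qed.

Lemma traverse0 (g : G) (a : letter) : traverse g a 0 = PV g.
Proof.
case: a => j [] /=; rewrite /traverse /= ?edge_map0 // subr0 edge_map1.
by have := gmul_linvK g (j, true); rewrite /linv /= => ->.
Qed.

Lemma traverse1 (g : G) (a : letter) : traverse g a 1 = PV (gmul g [:: a]).
Proof. by case: a => j []; rewrite /traverse /= ?subrr ?edge_map0 ?edge_map1. Qed.

Lemma traverse_linv (g : G) (a : letter) (u : R) :
  traverse (gmul g [:: a]) (linv a) u = traverse g a (1 - u).
Proof.
case: a => j []; rewrite /traverse /linv /=; first by rewrite subKr.
by have := gmul_linvK g (j, false); rewrite /linv /= => ->.
Qed.

Lemma loop_pt_vertex (g : G) (w : word) (k : nat) :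
  loop_pt g w k%:R = PV (gmul g (take k w)).
Proof. by rewrite /loop_pt natrK subrr eqxx. Qed.

Lemma loop_pt0 (g : G) (w : word) : loop_pt g w 0 = PV g.
Proof. by rewrite (loop_pt_vertex g w 0) take0 gmul_nil. Qed.

Lemma loop_pt_edge (g : G) (w : word) (k : nat) (u : R) :
  (k < size w)%N -> 0 <= u <= 1 ->
  loop_pt g w (k%:R + u) = traverse (gmul g (take k w)) (nth (false, false) w k) u.
Proof.
move=> kw /andP[u0 u1].
have tS : take k.+1 w = take k w ++ [:: nth (false, false) w k].
  by rewrite (take_nth (false, false) kw) cats1.
move: u0; rewrite le_eqVlt => /orP[/eqP <-|u0].
  by rewrite addr0 loop_pt_vertex traverse0.
move: u1; rewrite le_eqVlt => /orP[/eqP ->|u1].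
  by rewrite traverse1 natr1 loop_pt_vertex tS gmul_cat.
rewrite /loop_pt (@truncn_def _ _ k); last by rewrite -natr1; apply/andP; split; lra.
rewrite addrC addKr gt_eqF //; rewrite /traverse tS -gmul_cat.
by case: (nth _ _ _) => j [] /=; rewrite edge_mapE //; apply/andP; split; lra.
Qed.

Lemma nat_frac (n : nat) (s : R) : 0 <= s <= n.+1%:R ->
  exists k u, [/\ (k < n.+1)%N, 0 <= u <= 1 & s = k%:R + u].
Proof.
elim: n => [|n IH] /andP[s0 sn]; first by exists 0%N, s; rewrite s0 sn add0r.
have [h|h] := lerP s n.+1%:R.
  by have [|k [u [kn hu e]]] := IH; [rewrite s0|exists k, u; split=> //; exact: ltnW].
exists n.+1, (s - n.+1%:R); split=> //; last by rewrite addrCA subrr addr0.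
by move: sn; rewrite -[n.+2%:R]natr1 => sn; apply/andP; split; lra.
Qed.

Lemma loop_pt_catl (g : G) (u v : word) (s : R) : 0 <= s <= (size u)%:R ->
  loop_pt g (u ++ v) s = loop_pt g u s.
Proof.
case: u => [|a u] /=.
  by move=> h; have -> : s = 0 by [lra]; rewrite !loop_pt0.
case/nat_frac => k [t [kn ht ->]].
rewrite -cat_cons !loop_pt_edge ?size_cat //; last by rewrite ltn_addr.
by rewrite nth_cat takel_cat ?kn //; exact: ltnW.
Qed.

Lemma loop_pt_catr (g : G) (u v : word) (s : R) : 0 <= s <= (size v)%:R ->
  loop_pt g (u ++ v) ((size u)%:R + s) = loop_pt (gmul g u) v s.
Proof.
case: v => [|a v] /=.
  move=> h; have -> : s = 0 by [lra].
  by rewrite addr0 cats0 loop_pt_vertex take_size loop_pt0.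
case/nat_frac => k [t [kn ht ->]].
rewrite addrA -natrD !loop_pt_edge ?size_cat ?ltn_add2l //.
by rewrite nth_cat ltnNge leq_addr addKn gmul_cat take_cat ltnNge leq_addr addKn.
Qed.

Lemma loop_pt_letter (g : G) (a : letter) (u : R) : 0 <= u <= 1 ->
  loop_pt g [:: a] u = traverse g a u.
Proof. by move=> hu; rewrite -[u]add0r (loop_pt_edge g (k := 0)) //= gmul_nil add0r. Qed.

Definition graph_open (V : set pt) : Prop :=
  forall g j, relopen I01 (edge_map g j @^-1` V).

Lemma cw_open_graph (U : set pt) : cw_open U -> graph_open U.
Proof. by case. Qed.

Lemma traverse_open (V : set pt) (g : G) (a : letter) : graph_open V ->
  relopen I01 (traverse g a @^-1` V).
Proof.
case: a => j [] oV; rewrite /traverse /=; last exact: oV.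
apply: (@relopen_comp _ _ I01 I01 (fun u : R => 1 - u) _ _ _ (oV _ j)).
  by move=> x; rewrite /I01 /= => /andP[? ?]; apply/andP; split; lra.
by move=> x _; move: x; prove_cont.
Qed.

Lemma loop_pt_open (V : set pt) (g : G) (w : word) : graph_open V ->
  relopen [set s : R | 0 <= s <= (size w)%:R] (loop_pt g w @^-1` V).
Proof.
move=> oV; suff H k : (k <= size w)%N ->
    relopen [set s : R | 0 <= s <= k%:R] (loop_pt g w @^-1` V) by exact: H.
elim: k => [|k IH] kw.
  move=> x Dx Vx; apply: filterE => y Dy.
  by have -> : y = x; first by move: Dx Dy => /=; lra.
apply: (@relopen_split _ _ _ (fun s => s) k%:R); first exact: ctn_id.
  apply: relopen_sub (IH (ltnW kw)) => s /= [/andP[h1 _] h2]; exact/andP.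
pose a := nth (false, false) w k.
apply: (@relopen_ext _ _ ((fun s => s - k%:R) @^-1` (traverse (gmul g (take k w)) a @^-1` V))).
  move=> s /= [/andP[h1 h2] h3].
  have {2}-> : s = k%:R + (s - k%:R) by lra.
  rewrite loop_pt_edge //.
  by move: h2; rewrite -natr1 => h2; apply/andP; split; lra.
apply: (@relopen_comp _ _ _ I01); [|by move=> x _; move: x; prove_cont|exact: traverse_open].
move=> s /= [/andP[h1 h2] h3]; rewrite /I01 /=.
by move: h2; rewrite -natr1 => h2; apply/andP; split; lra.
Qed.

Lemma traverse_X1 (g : G) (a : letter) (u : R) : X1 (traverse g a u).
Proof.
have h j (h : G) v : X1 (edge_map h j v).
  by rewrite /edge_map; do 2!case: ifP => _ //; rewrite /mkE; case: insub.
by rewrite /traverse; case: ifP.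
Qed.

Lemma loop_pt_X1 (g : G) (w : word) (s : R) : X1 (loop_pt g w s).
Proof.
rewrite /loop_pt; case: ifP => // _; case: (nth _ _ _) => j [];
by rewrite /mkE; case: insub.
Qed.

(** A right inverse of [perim] on [0,4), written with clamps instead of cases so that its continuity
    is immediate. *)
Definition bd (t : R) : R * R :=
  (Num.max 0 (Num.min (Num.min 1 t) (3 - t)),
   Num.max 0 (Num.min (Num.min 1 (t - 1)) (4 - t))).

Lemma cont_bd : continuous bd.
Proof. by rewrite /bd; prove_cont. Qed.

Lemma bd_sq01 (t : R) : sq01 (bd t).
Proof.
rewrite /sq01 /bd /=; split; rewrite le_max lexx ge_max ler01 !ge_min lexx //.
Qed.

Lemma bdE (t : R) : 0 <= t <= 4 ->
  [\/ t <= 1 /\ bd t = (t, 0), 1 < t <= 2 /\ bd t = (1, t - 1),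
      2 < t <= 3 /\ bd t = (3 - t, 1) | 3 < t /\ bd t = (0, 4 - t)].
Proof.
move=> /andP[t0 t4].
have min1 (x y : R) : x <= y -> Num.min x y = x by exact: min_l.
have min2 (x y : R) : y <= x -> Num.min x y = y by exact: min_r.
have max1 (x y : R) : y <= x -> Num.max x y = x by exact: max_l.
have max2 (x y : R) : x <= y -> Num.max x y = y by exact: max_r.
have bdq (a b c d : R) : Num.min 1 t = a -> Num.min a (3 - t) = b ->
    Num.min 1 (t - 1) = c -> Num.min c (4 - t) = d ->
    bd t = (Num.max 0 b, Num.max 0 d) by rewrite /bd => -> -> -> ->.
have [h1|h1] := lerP t 1.
  constructor 1; split=> //.
  rewrite (bdq t t (t - 1) (t - 1)); try (apply: min1; lra); try (apply: min2; lra).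
  by rewrite (max2 0 t) ?(max1 0 (t - 1)) //; lra.
have [h2|h2] := lerP t 2.
  constructor 2; split; first exact/andP.
  rewrite (bdq 1 1 (t - 1) (t - 1)); try (apply: min1; lra); try (apply: min2; lra).
  by rewrite (max2 0 1) ?(max2 0 (t - 1)) //; lra.
have [h3|h3] := lerP t 3.
  constructor 3; split; first exact/andP.
  rewrite (bdq 1 (3 - t) 1 1); try (apply: min1; lra); try (apply: min2; lra).
  by rewrite (max2 0 1) ?(max2 0 (3 - t)) //; lra.
constructor 4; split=> //.
rewrite (bdq 1 (3 - t) 1 (4 - t)); try (apply: min1; lra); try (apply: min2; lra).
by rewrite (max1 0 (3 - t)) ?(max2 0 (4 - t)) //; lra.
Qed.

Lemma bd_boundary (t : R) : 0 <= t <= 4 ->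
  (0 < (bd t).1 < 1) && (0 < (bd t).2 < 1) = false.
Proof.
move=> ht; apply/negbTE/negP => /andP[/andP[a1 a2] /andP[b1 b2]].
by case: (bdE ht) a1 a2 b1 b2 => [] [_ ->] /= *; lra.
Qed.

Lemma perim_bd (t : R) : 0 <= t < 4 -> perim (bd t) = t.
Proof.
move=> /andP[t0 t4]; rewrite /perim.
have ht : 0 <= t <= 4 by apply/andP; split; lra.
case: (bdE ht) => [] [h ->] /=; do ?case: eqP => /= *; lra.
Qed.

Lemma perim_bd4 : perim (bd 4) = 0.
Proof.
rewrite /perim; have ht : 0 <= (4 : R) <= 4 by apply/andP; split; lra.
by case: (bdE ht) => [] [h ->] /=; do ?case: eqP => /= *; lra.
Qed.

Lemma size_relator (i : bool) : size (relator i) = if i then 14 else 10.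
Proof. by case: i. Qed.

Lemma size_relator_gt0 (i : bool) : 0 < (size (relator i))%:R :> R.
Proof. by rewrite ltr0n size_relator; case: i. Qed.

Lemma cell_map_bd (g : G) (i : bool) (s : R) : 0 <= s <= (size (relator i))%:R ->
  cell_map g i (bd (s * 4 / (size (relator i))%:R)) = loop_pt g (relator i) s.
Proof.
move=> /andP[s0 sn]; have n0 := size_relator_gt0 i.
set n := (size _)%:R in sn n0 *.
have t0 : 0 <= s * 4 / n by rewrite divr_ge0 ?mulr_ge0 // ltW.
have t4 : s * 4 / n <= 4 by rewrite ler_pdivrMr //; lra.
rewrite /cell_map bd_boundary ?t0 //.
move: sn; rewrite le_eqVlt => /orP[/eqP e|sn].
  have -> : s * 4 / n = 4 by rewrite e mulrC mulKf ?gt_eqF.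
  rewrite perim_bd4 !mul0r loop_pt0 e.
  by rewrite loop_pt_vertex take_size gmul_relator.
rewrite perim_bd ?t0 /=; last by rewrite ltr_pdivrMr //; lra.
by rewrite -/n divfK ?gt_eqF // mulfK // pnatr_eq0.
Qed.

Lemma bd_surj (p : R * R) : sq01 p -> (0 < p.1 < 1) && (0 < p.2 < 1) = false ->
  0 <= perim p <= 4 /\ p = bd (perim p).
Proof.
case: p => x y; rewrite /sq01 /= => -[/andP[x0 x1] /andP[y0 y1]] hi.
have b : [\/ x = 0, x = 1, y = 0 | y = 1].
  have [e|ex] := eqVneq x 0; first by constructor 1.
  have [e|ex1] := eqVneq x 1; first by constructor 2.
  have [e|ey] := eqVneq y 0; first by constructor 3.
  have [e|ey1] := eqVneq y 1; first by constructor 4.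
  by move: hi; rewrite !lt_def x0 y0 ex ey x1 y1 (eq_sym 1) ex1 (eq_sym 1) ey1.
have hp : 0 <= perim (x, y) <= 4.
  by rewrite /perim /=; do ?case: ifP => _; apply/andP; split; lra.
split=> //; move: hp; rewrite /perim /=.
have [e|ey] := eqVneq y 0.
  by rewrite e => h; case: (bdE h) => [] [? ->]; congr pair; lra.
have [e|ex1] := eqVneq x 1.
  move=> h; have y0' : 0 < y by rewrite lt_def ey.
  by case: (bdE h) => [] [? ->]; congr pair; lra.
have x1' : x < 1 by rewrite lt_def eq_sym ex1.
have [e|ey1] := eqVneq y 1.
  by move=> h; case: (bdE h) => [] [? ->]; congr pair; lra.
have y1' : y < 1 by rewrite lt_def eq_sym ey1.
have y0' : 0 < y by rewrite lt_def ey.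
have ex : x = 0 by case: b => // e; rewrite e eqxx in ex1 ey ey1.
by move=> h; case: (bdE h) => [] [? ->]; congr pair; lra.
Qed.

(* X1 is closed in X, so a subset of X1 that is open in X1 becomes open in X after
   adding all the open 2-cells. *)
Lemma cw_open_extend (V : set pt) : graph_open V -> cw_open (V `|` ~` X1).
Proof.
move=> oV; split=> g i.
  apply: relopen_ext (oV g i) => t _ /=; split=> [|[//|]]; first by left.
  by case; exact: (traverse_X1 g (i, false) t).
have n0 := size_relator_gt0 i; set n : R := (size (relator i))%:R in n0.
pose J := [set s : R | 0 <= s <= n].
pose h (s : R) := bd (s * 4 / n).
have cJ : compact J by have := @segment_compact R 0 n; rewrite set_itvcc.
have ch : continuous h.
  by apply: (ctn_comp (f := fun s : R => s * 4 / n) _ cont_bd); prove_cont.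
have hJ s : J s -> cell_map g i (h s) = loop_pt g (relator i) s by exact: cell_map_bd.
move=> p Dp Vp.
have inner (q : R * R) : (0 < q.1 < 1) && (0 < q.2 < 1) -> ~ X1 (cell_map g i q).
  by move=> hq; rewrite /cell_map hq /mkC insubT.
have [/andP[/andP[h1 h2] /andP[h3 h4]]|hi] := boolP ((0 < p.1 < 1) && (0 < p.2 < 1)).
  have c1 : {for p, continuous (fun q : R * R => q.1)} := @ctn_fst R R p.
  have c2 : {for p, continuous (fun q : R * R => q.2)} := @ctn_snd R R p.
  have n1 := @near_gt R _ _ _ _ c1 h1; have n2 := @near_lt R _ _ _ _ c1 h2.
  have n3 := @near_gt R _ _ _ _ c2 h3; have n4 := @near_lt R _ _ _ _ c2 h4.
  apply: near_sub (near_and (near_and n1 n2) (near_and n3 n4)) => q [[/= q1 q2] [/= q3 q4]] _.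
  right; apply: inner.
  by rewrite q1 q2 q3 q4.
have Vp' : V (cell_map g i p).
  case: Vp => [//|[]]; rewrite /cell_map (negbTE hi); exact: loop_pt_X1.
(* By compactness of the perimeter it is enough to argue near each s: either the loop stays in V
   there, or [h s] differs from p. *)
pose P (q : R * R) (s : R) := J s -> q = h s -> V (loop_pt g (relator i) s).
have : \forall q \near p, forall s, J s -> P q s.
  apply: (near_tube cJ) => s Js.
  have [Vs|nVs] := pselect (V (loop_pt g (relator i) s)).
    have ns := @loop_pt_open V g (relator i) oV s Js Vs.
    have nz : \forall z \near (s, p), J z.1 -> V (loop_pt g (relator i) z.1).
      exact: (@ctn_fst R (R * R)%type (s, p) _ ns).
    by apply: near_sub nz => -[s' q] /= hz Js' _; exact: hz.
  (* The sup distance from the boundary point to q. It is positive at [(s, p)], hence nearby, where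
     [q = h s'] is thus impossible. *)
  pose d (z : R * (R * R)) : R := Num.max (Num.max ((h z.1).1 - z.2.1) (z.2.1 - (h z.1).1))
      (Num.max ((h z.1).2 - z.2.2) (z.2.2 - (h z.1).2)).
  have cd : continuous d.
    have chz : continuous (fun z : R * (R * R) => h z.1).
      by apply: ctn_comp ch; exact: ctn_fst.
    have c21 : continuous (fun z : R * (R * R) => z.2.1).
      by apply: (ctn_comp (f := fun z => z.2)); [exact: ctn_snd|exact: ctn_fst].
    have c22 : continuous (fun z : R * (R * R) => z.2.2).
      by apply: (ctn_comp (f := fun z => z.2)); exact: ctn_snd.
    have ch1 : continuous (fun z : R * (R * R) => (h z.1).1).
      by apply: (ctn_comp chz); exact: ctn_fst.
    have ch2 : continuous (fun z : R * (R * R) => (h z.1).2).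
      by apply: (ctn_comp chz); exact: ctn_snd.
    by apply: (@ctn_max R); apply: (@ctn_max R); apply: (@ctn_add R) => //; apply: (@ctn_opp R).
  have d0 : 0 < d (s, p).
    have [e1|e1] := eqVneq (h s).1 p.1; last first.
      by rewrite /d !lt_max !subr_gt0 /=; move: e1; rewrite neq_lt => /orP[] ->; rewrite ?orbT.
    have [e2|e2] := eqVneq (h s).2 p.2; last first.
      by rewrite /d !lt_max !subr_gt0 /=; move: e2; rewrite neq_lt => /orP[] ->; rewrite ?orbT.
    case: nVs; rewrite -hJ //; suff -> : h s = p by [].
    by rewrite [h s]surjective_pairing e1 e2 -surjective_pairing.
  have nz := @near_gt R _ _ _ _ (cd (s, p)) d0.
  apply: near_sub nz => -[s' q] /= dz Js' e.
  by move: dz; rewrite /d /= e !subrr !maxxx ltxx.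
apply: near_sub => q Pq Dq.
have [hq|hq] := boolP ((0 < q.1 < 1) && (0 < q.2 < 1)); first by right; exact: inner.
left; have [/andP[a1 a2] eq] := bd_surj Dq (negbTE hq).
have eh : q = h (perim q * n / 4).
  by rewrite {1}eq /h; congr bd; rewrite divfK ?pnatr_eq0 // mulfK // gt_eqF.
have Js : J (perim q * n / 4).
  rewrite /J /=; apply/andP; split; first by rewrite divr_ge0 ?mulr_ge0 // ltW.
  by rewrite ler_pdivrMr // mulrC ler_pM2l.
rewrite /preimage /= {1}eh hJ //; exact: Pq.
Qed.

(** * Combing homotopies *)

(* 45 = 4 * 11 + 1 is the constant of the theorem. *)
Definition at_level (n : nat) (x : pt) : Prop :=
  lev x <= 4 * n%:R + 1 /\ n%:R <= lev x + 11.

Lemma lev_traverse (m M : R) (g : G) (a : letter) (u : R) : 0 <= u <= 1 ->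
  m <= (wlen g)%:R <= M -> m <= (wlen (gmul g [:: a]))%:R <= M ->
  m <= lev (traverse g a u) <= M + 1 / 4.
Proof.
move=> /andP[u0 u1] /andP[g1 g2] /andP[h1 h2].
have mid j (h : G) t : 0 < t < 1 -> edge_map h j t = mkE h j t /\
    lev (mkE h j t) = ((wlen h)%:R + (wlen (gmul h [:: (j, false)]))%:R) / 2 + 1 / 4.
  by move=> ht; rewrite edge_mapE // /mkE insubT.
have [->|nu0] := eqVneq u 0; first by rewrite traverse0 /=; apply/andP; split; lra.
have [->|nu1] := eqVneq u 1; first by rewrite traverse1 /=; apply/andP; split; lra.
have u0' : 0 < u by rewrite lt_def nu0.
have u1' : u < 1 by rewrite lt_def eq_sym nu1.
rewrite /traverse; case: a h1 h2 => j [] /= h1 h2.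
  have [|-> ->] := mid j (gmul g [:: (j, true)]) (1 - u); first by apply/andP; split; lra.
  have := gmul_linvK g (j, true); rewrite /linv /= => ->.
  by apply/andP; split; lra.
have [|-> ->] := mid j g u; first by apply/andP; split.
by apply/andP; split; lra.
Qed.

Lemma lev_loop_pt (m M : R) (g : G) (w : word) (s : R) :
  0 <= s <= (size w)%:R ->
  (forall k, (k <= size w)%N -> m <= (wlen (gmul g (take k w)))%:R <= M) ->
  m <= lev (loop_pt g w s) <= M + 1 / 4.
Proof.
case: (posnP (size w)) => [e|sw] hs h.
  have -> : s = 0 by move: hs; rewrite e; lra.
  rewrite loop_pt0 /=; have := h 0%N isT; rewrite take0 gmul_nil => /andP[? ?].
  by apply/andP; split; lra.
move: hs; rewrite -(prednK sw) => /nat_frac[k [u [kn hu ->]]].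
rewrite (prednK sw) in kn; rewrite loop_pt_edge //.
apply: lev_traverse => //; first by apply: h; exact: ltnW.
by rewrite gmul_cat cats1 -take_nth //; apply: h.
Qed.

Lemma lev_cell_map (m M : R) (g : G) (i : bool) (p : R * R) : sq01 p ->
  (forall k, (k <= size (relator i))%N ->
     m <= (wlen (gmul g (take k (relator i))))%:R <= M) ->
  m <= lev (cell_map g i p) <= M + 1 / 2.
Proof.
move=> Dp h; have n0 := size_relator_gt0 i.
have [hi|/negbTE hi] := boolP ((0 < p.1 < 1) && (0 < p.2 < 1)).
  rewrite /cell_map hi /mkC insubT /=.
  have hm : m * (size (relator i))%:R <=
      \sum_(k < size (relator i)) (wlen (gmul g (take k (relator i))))%:R.
    rewrite -[X in X%:R]card_ord mulr_natr -sumr_const.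
    by apply: ler_sum => k _; case/andP: (h k (ltnW (ltn_ord k))).
  have hM : \sum_(k < size (relator i)) (wlen (gmul g (take k (relator i))))%:R <=
      M * (size (relator i))%:R.
    rewrite -[X in _ <= M * X%:R]card_ord mulr_natr -sumr_const.
    by apply: ler_sum => k _; case/andP: (h k (ltnW (ltn_ord k))).
  have c0 : 0 < 1 / cconst <= 1 / 4.
    have c4 : 4 <= cconst by rewrite /cconst ler_nat.
    have c0 : 0 < cconst by apply: lt_le_trans c4.
    by rewrite !div1r invr_gt0 c0 /= lef_pV2 // posrE.
  set S := \sum_(k < _) _ in hm hM *; set z := (size _)%:R in n0 hm hM *.
  have {}hm : m <= S / z by rewrite ler_pdivlMr.
  have {}hM : S / z <= M by rewrite ler_pdivrMr.
  by case/andP: c0 => ? ?; apply/andP; split; lra.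
have [/andP[a1 a2] eq] := bd_surj Dp hi.
rewrite /cell_map hi.
have /andP[h1 h2] : m <= lev (loop_pt g (relator i) (perim p * (size (relator i))%:R / 4)) <= M + 1 / 4.
  apply: lev_loop_pt => //; apply/andP; split; first by rewrite divr_ge0 ?mulr_ge0 // ltW.
  by rewrite ler_pdivrMr // mulrC ler_pM2l.
by apply/andP; split; lra.
Qed.

(** Two vertices of a cycle of length at most 2c are joined by an arc of length at most c. *)
Lemma cycle_lipschitz (f : nat -> nat) (n c : nat) : (n <= c.*2)%N ->
  (forall k, (k < n)%N -> (f k.+1 <= (f k).+1)%N /\ (f k <= (f k.+1).+1)%N) -> f n = f 0%N ->
  forall j k, (j <= n)%N -> (k <= n)%N -> (f j <= f k + c)%N.
Proof.
move=> nc h e.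
have l d j : (j + d <= n)%N -> (f j <= f (j + d)%N + d)%N /\ (f (j + d)%N <= f j + d)%N.
  elim: d => [|d IH]; rewrite ?addn0 // addnS => jd.
  by have [|h1 h2] := h (j + d)%N => //; have [|h3 h4] := IH; lia.
move=> j k jn kn.
have := l j 0%N; have := l k 0%N; have := l (n - j)%N j; have := l (n - k)%N k.
rewrite !add0n !subnKC // !leqnn e => /(_ isT) [a1 a2] /(_ isT) [b1 b2] /(_ kn) [c1 c2] /(_ jn) [d1 d2].
have [jk|kj] := leqP j k.
  by have := l (k - j)%N j; rewrite subnKC // => /(_ kn) [? ?]; lia.
by have := l (j - k)%N k; rewrite subnKC ?(ltnW kj) // => /(_ jn) [? ?]; lia.
Qed.

Lemma cell_level (g : G) (i : bool) (n : nat) (p : R * R) : sq01 p ->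
  (forall k, (k <= size (relator i))%N -> (groom (gmul g (take k (relator i))) <= n)%N) ->
  (exists2 k, (k <= size (relator i))%N & (n <= groom (gmul g (take k (relator i))))%N) ->
  at_level n (cell_map g i p).
Proof.
move=> Dp h [k0 k0s hk0]; set r := relator i in h k0s hk0 *.
pose f k := wlen (gmul g (take k r)).
have fc j k : (j <= size r)%N -> (k <= size r)%N -> (f j <= f k + 7)%N.
  apply: cycle_lipschitz; first by rewrite /r size_relator; case: (i).
    move=> l lr; rewrite /f (take_nth (false, false)) // -cats1 -gmul_cat.
    by split; [exact: wlen_gmul1|exact: wlen_gmul1r].
  by rewrite /f take_size take0 gmul_nil gmul_relator.
(* 9 = 7 + 2: half the length of the longer relator, plus the gap in [groom_wlen]. *)
have /andP[? ?] : n%:R - 9 <= lev (cell_map g i p) <= 4 * n%:R + 1 / 2; last by split; lra.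
apply: lev_cell_map => //.
  move=> k kr; rewrite -/(f k); have := fc _ _ k0s kr.
  have := groom_wlen (gmul g (take k0 r)); rewrite -/(f k0) => h1 h2.
  have := wlen_groom (gmul g (take k r)); rewrite -/(f k) => h3.
  have := h k kr => h4; apply/andP; split.
    rewrite lerBlDr -natrD ler_nat; lia.
  rewrite -natrM ler_nat; lia.
Qed.

Definition gword (g : G) : word := nform (gst g).

Definition gpath (g : G) (t : R) : pt :=
  loop_pt eps (gword g) (Num.min t (size (gword g))%:R).

(** [nu] is a monotone substitute for N at points that need not be vertices. The bound n allows a
    path to be continued at level n. *)
Definition tame_path (n : nat) (f : R -> pt) : Prop := exists nu : R -> nat,
  (forall t t', 0 <= t -> t <= t' -> (nu t <= nu t')%N) /\
  (forall t, 0 <= t -> at_level (nu t) (f t) /\ (nu t <= n)%N).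

Definition strip (w : word) : set (R * R) :=
  [set p | 0 <= p.1 <= (size w)%:R /\ 0 <= p.2].

(* Time is unbounded and each path stops when it reaches its end point, so that the paths of
   the end points of an edge need no reparametrization when a cell is added. *)
Definition combed (g : G) (w : word) (n : nat) : Prop := exists (H : R -> R -> pt) (T : R),
  [/\ forall U, cw_open U -> relopen (strip w) ((fun p => H p.1 p.2) @^-1` U),
      forall t, 0 <= t -> H 0 t = gpath g t /\ H (size w)%:R t = gpath (gmul g w) t,
      0 <= T,
      forall s t, 0 <= s <= (size w)%:R -> T <= t -> H s t = loop_pt g w s &
      forall s, 0 <= s <= (size w)%:R -> H s 0 = PV eps /\ tame_path n (H s)].

Lemma combed_leq (g : G) (w : word) (m n : nat) : (m <= n)%N -> combed g w m -> combed g w n.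
Proof.
move=> mn [H [T [h1 h2 h3 h4 h5]]]; exists H, T; split=> // s hs.
have [h6 [nu [n1 n2]]] := h5 s hs; split=> //; exists nu; split=> // t t0.
by have [? ?] := n2 t t0; split=> //; exact: leq_trans mn.
Qed.

Lemma gmul_gword (g : G) : gmul eps (gword g) = g.
Proof. by rewrite gmul_cls cls_nform. Qed.

Lemma groom_take (g : G) (k : nat) :
  groom (gmul eps (take k (gword g))) = room (acts (take k (nform (gst g))) st0).
Proof. by rewrite /groom gst_gmul gst_eps. Qed.

Lemma groom_take_leq (g : G) (j k : nat) : (j <= k)%N ->
  (groom (gmul eps (take j (gword g))) <= groom (gmul eps (take k (gword g))))%N.
Proof. by move=> jk; rewrite !groom_take; apply: room_nform => //; exact: supported_gst. Qed.

(** Take for [nu] the value of N one vertex ahead on the normal form, which dominates both ends of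
    the current edge. *)
Lemma tame_gword (g : G) (f : R -> R) :
  (forall t, 0 <= t -> 0 <= f t <= (size (gword g))%:R) ->
  (forall t t', 0 <= t -> t <= t' -> f t <= f t') ->
  tame_path (groom g) (fun t => loop_pt eps (gword g) (f t)).
Proof.
move=> fr fm; set w := gword g in fr *.
exists (fun t => groom (gmul eps (take (Num.truncn (f t)).+1 w))); split=> [t t' t0 tt'|t t0].
  by apply: groom_take_leq; rewrite ltnS; apply: le_truncn; exact: fm.
split; last first.
  have -> : groom g = groom (gmul eps (take (size w) w)) by rewrite take_size gmul_gword.
  have [h|h] := leqP (Num.truncn (f t)).+1 (size w); first exact: groom_take_leq.
  by rewrite !take_oversize // ltnW.
have /andP[f0 f1] := fr t t0.
have /andP[k1 k2] := truncn_itv f0; set k := Num.truncn (f t) in k1 k2 *.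
have mono := @groom_take_leq g k k.+1 (leqnSn k).
have w1 := wlen_groom (gmul eps (take k w)).
have w2 := wlen_groom (gmul eps (take k.+1 w)).
have r2 := groom_wlen (gmul eps (take k.+1 w)).
have [kw|kw] := ltnP k (size w); last first.
  have e : f t = k%:R.
    apply/eqP; rewrite eq_le k1 andbT; apply: le_trans f1 _; by rewrite ler_nat.
  rewrite e loop_pt_vertex /at_level /=.
  move: w2 r2; rewrite !take_oversize //; last exact: leqW.
  rewrite -(ler_nat R) natrM => h1; rewrite -(ler_nat R) natrD => h2; split; lra.
have tS : gmul eps (take k.+1 w) = gmul (gmul eps (take k w)) [:: nth (false, false) w k].
  by rewrite (take_nth (false, false) kw) -cats1 gmul_cat.
have l1 := wlen_gmul1 (gmul eps (take k w)) (nth (false, false) w k).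
rewrite -tS in l1; set N := groom (gmul eps (take k.+1 w)) in mono w2 r2 *.
have -> : f t = k%:R + (f t - k%:R) by lra.
rewrite loop_pt_edge //; last first.
  by move: k2; rewrite -natr1 => k2; apply/andP; split; lra.
(* 3 = 1 + 2: one letter between the ends, plus the gap in [groom_wlen]. *)
have /andP[? ?] : N%:R - 3 <= lev (traverse (gmul eps (take k w)) (nth (false, false) w k) (f t - k%:R)) <= 4 * N%:R + 1 / 4.
  apply: lev_traverse; rewrite -?tS.
  - by move: k2; rewrite -natr1 => k2; apply/andP; split; lra.
  - rewrite lerBlDr -natrD -natrM !ler_nat -/w; apply/andP; split; first by lia.
    by apply: leq_trans w1 _; rewrite leq_mul2l.
  - by rewrite lerBlDr -natrD -natrM !ler_nat; apply/andP; split; lia.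
by split; lra.
Qed.

Lemma gpath0 (g : G) : gpath g 0 = PV eps.
Proof. by rewrite /gpath min_l ?ler0n // loop_pt0. Qed.

Lemma gpath_end (g : G) (t : R) : (size (gword g))%:R <= t -> gpath g t = PV g.
Proof. by move=> h; rewrite /gpath min_r // loop_pt_vertex take_size gmul_gword. Qed.

Lemma tame_gpath (g : G) : tame_path (groom g) (gpath g).
Proof.
apply: tame_gword => [t t0|t t' t0 tt']; first by rewrite le_min t0 ler0n ge_min lexx orbT.
by rewrite le_min !ge_min tt' lexx /= orbT.
Qed.

Lemma gpath_open (g : G) (U : set pt) : cw_open U ->
  relopen [set t : R | 0 <= t] (gpath g @^-1` U).
Proof.
move=> oU.
apply: (@relopen_comp _ _ _ [set s : R | 0 <= s <= (size (gword g))%:R]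
  (fun t : R => Num.min t (size (gword g))%:R) (loop_pt eps (gword g) @^-1` U)).
- by move=> t /= t0; rewrite le_min t0 ler0n ge_min lexx orbT.
- by move=> t _; move: t; prove_cont.
- exact/loop_pt_open/cw_open_graph.
Qed.

Lemma combed_nil (g : G) : combed g [::] (groom g).
Proof.
exists (fun _ => gpath g), (size (gword g))%:R; split.
- move=> U oU; apply: (@relopen_comp _ _ _ [set t : R | 0 <= t] (fun p : R * R => p.2) (gpath g @^-1` U)).
  + by move=> p [].
  + by move=> p _; move: p; prove_cont.
  + exact: gpath_open.
- by move=> t t0; rewrite gmul_nil.
- exact: ler0n.
- move=> s t hs tT; rewrite gpath_end //.
  by have -> : s = 0; [move: hs => /=; lra|rewrite loop_pt0].
- by move=> s _; split; [exact: gpath0|exact: tame_gpath].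
Qed.

(** The normal form of the far end runs along the edge, so the path to a point of the edge is that
    normal form stopped early. *)
Lemma combed_tree (g : G) (a : letter) :
  gword (gmul g [:: a]) = rcons (gword g) a -> combed g [:: a] (groom (gmul g [:: a])).
Proof.
move=> e; set h := gmul g [:: a] in e *; set w := gword g in e.
have sz : (size (gword h))%:R = (size w)%:R + 1 :> R by rewrite e size_rcons -natr1.
have w0 : 0 <= (size w)%:R :> R by exact: ler0n.
have rng (s t : R) : 0 <= s <= 1 -> 0 <= t ->
    0 <= Num.min t ((size w)%:R + s) <= (size (gword h))%:R.
  move=> /andP[s0 s1] t0; rewrite le_min t0 /= addr_ge0 // ge_min sz lerD2l s1 orbT //.
exists (fun s t => loop_pt eps (gword h) (Num.min t ((size w)%:R + s))), ((size w)%:R + 1).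
split.
- move=> U oU.
  apply: (@relopen_comp _ _ _ [set s : R | 0 <= s <= (size (gword h))%:R]
    (fun p : R * R => Num.min p.2 ((size w)%:R + p.1)) (loop_pt eps (gword h) @^-1` U)).
  + by move=> [s t] [/= hs ht]; exact: rng.
  + by move=> t _; move: t; prove_cont.
  + exact/loop_pt_open/cw_open_graph.
- move=> t t0; rewrite addr0 /= -sz; split=> //.
  by rewrite /gpath -/w e -cats1 loop_pt_catl // le_min t0 w0 ge_min lexx orbT.
- by rewrite addr_ge0.
- move=> s t hs tT; rewrite min_r; last by move: hs tT => /=; lra.
  by rewrite e -cats1 loop_pt_catr // gmul_gword.
- move=> s hs; split; first by rewrite min_l ?loop_pt0 // addr_ge0 //; case/andP: hs.
  apply: tame_gword; first by move=> t; exact: rng.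
  by move=> t t' t0 tt'; rewrite le_min !ge_min tt' lexx /= orbT.
Qed.

Lemma combed_rev (g : G) (a : letter) (n : nat) :
  combed g [:: a] n -> combed (gmul g [:: a]) [:: linv a] n.
Proof.
case=> H [T [h1 h2 h3 h4 h5]].
have rng (s : R) : 0 <= s <= 1 -> 0 <= 1 - s <= 1 by move=> /andP[? ?]; apply/andP; split; lra.
exists (fun s => H (1 - s)), T; split=> //.
- move=> U oU.
  apply: (@relopen_comp _ _ _ (strip [:: a]) (fun p : R * R => (1 - p.1, p.2))
    ((fun p : R * R => H p.1 p.2) @^-1` U)); last exact: h1.
    by move=> [s t] [/= hs ht]; split=> //; exact: rng.
  by move=> p _; move: p; prove_cont.
- move=> t t0; have [e0 e1] := h2 t t0.
  by rewrite subr0 subrr gmul_linvK.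
- move=> s t hs tT; rewrite h4 //; last exact: rng.
  by rewrite !loop_pt_letter ?traverse_linv //; exact: rng.
- by move=> s hs; apply: h5; exact: rng.
Qed.

Lemma combed_rcons (g : G) (w : word) (a : letter) (n : nat) :
  combed g w n -> combed (gmul g w) [:: a] n -> combed g (rcons w a) n.
Proof.
case=> H1 [T1 [a1 a2 a3 a4 a5]] [H2 [T2 [b1 b2 b3 b4 b5]]].
set m : R := (size w)%:R in a2 a4 a5.
have m0 : 0 <= m by exact: ler0n.
have sz : (size (rcons w a))%:R = m + 1 :> R by rewrite size_rcons -natr1.
exists (fun s t => if s <= m then H1 s t else H2 (s - m) t), (Num.max T1 T2).
have glue t : 0 <= t -> H1 m t = H2 0 t.
  by move=> t0; have [_ ->] := a2 t t0; have [->] := b2 t t0.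
split.
- move=> U oU; apply: (@relopen_split _ _ _ (fun p : R * R => p.1) m); first by prove_cont.
    apply: (@relopen_ext _ _ ((fun p : R * R => H1 p.1 p.2) @^-1` U)).
      by move=> [s t] [/= _ sm]; rewrite /preimage /= sm.
    by apply: relopen_sub (a1 U oU) => -[s t] [[/= /andP[s0 _] t0] sm]; split=> //=; exact/andP.
  apply: (@relopen_ext _ _ ((fun p : R * R => (p.1 - m, p.2)) @^-1` ((fun p : R * R => H2 p.1 p.2) @^-1` U))).
    move=> [s t] [[/= _ t0] sm]; rewrite /preimage /=; case: ifP => // sm'.
    by have -> : s = m; [lra|rewrite glue // subrr].
  apply: (@relopen_comp _ _ _ (strip [:: a])); last exact: b1.
    move=> [s t] [[/=]]; rewrite sz => /andP[s0 s1] t0 sm; split=> //=.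
    by apply/andP; split; lra.
  by move=> p _; move: p; prove_cont.
- move=> t t0; rewrite m0 sz; have [-> _] := a2 t t0; split=> //.
  case: ifP => [h|_]; first by exfalso; lra.
  rewrite addrC addKr; have [_ ->] := b2 t t0.
  by rewrite gmul_cat cats1.
- by rewrite le_max a3.
- move=> s t; rewrite sz ge_max => /andP[s0 s1] /andP[t1 t2].
  rewrite -cats1; case: ifP => sm.
    by rewrite a4 ?s0 // loop_pt_catl // s0.
  have {2}-> : s = m + (s - m) by lra.
  move/negbT: sm; rewrite -ltNge => sm.
  have hs : 0 <= s - m <= 1 by apply/andP; split; lra.
  by rewrite b4 // loop_pt_catr.
- move=> s; rewrite sz => /andP[s0 s1]; case: ifPn => sm; first by apply: a5; rewrite s0.
  by apply: b5 => /=; move: sm; rewrite -ltNge => sm; apply/andP; split; lra.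
Qed.

Lemma combed_word (g : G) (w : word) (n : nat) : (groom g <= n)%N ->
  (forall k, (k < size w)%N -> combed (gmul g (take k w)) [:: nth (false, false) w k] n) ->
  combed g w n.
Proof.
move=> gn; elim/last_ind: w => [|w a IH] h; first exact: combed_leq (combed_nil g).
apply: combed_rcons.
  apply: IH => k kw; have k1 : (k < size (rcons w a))%N by rewrite size_rcons; exact: leqW.
  have := h k k1; rewrite nth_rcons kw -cats1 takel_cat; last exact: ltnW.
  by apply.
have k1 : (size w < size (rcons w a))%N by rewrite size_rcons.
by have := h (size w) k1; rewrite nth_rcons ltnn eqxx -cats1 take_size_cat; [apply|].
Qed.

Lemma relopen_if (T : topologicalType) (D : set T) (U : set pt) (u : T -> R) (c : R)
    (f h : T -> pt) : continuous u ->
  (forall x, D x -> u x = c -> f x = h x) ->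
  relopen (D `&` [set x | u x <= c]) (f @^-1` U) ->
  relopen (D `&` [set x | c <= u x]) (h @^-1` U) ->
  relopen D ((fun x => if u x <= c then f x else h x) @^-1` U).
Proof.
move=> cu e hf hh; apply: (@relopen_split _ _ _ u c) => //.
  by apply: relopen_ext hf => x [_ /= xc]; rewrite /preimage /= xc.
apply: relopen_ext hh => x [Dx /= xc]; rewrite /preimage /=; case: ifP => // xc'.
by rewrite e //; apply/eqP; rewrite eq_le xc' xc.
Qed.

Definition seg (p q : R * R) (t : R) : R * R :=
  ((1 - t) * p.1 + t * q.1, (1 - t) * p.2 + t * q.2).

Lemma seg0 (p q : R * R) : seg p q 0 = p.
Proof. by case: p => x y; rewrite /seg /=; congr pair; lra. Qed.

Lemma seg1 (p q : R * R) : seg p q 1 = q.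
Proof. by case: q => x y; rewrite /seg /=; congr pair; lra. Qed.

Lemma segxx (p : R * R) (t : R) : seg p p t = p.
Proof. by case: p => x y; rewrite /seg /=; congr pair; lra. Qed.

Lemma seg_sq01 (p q : R * R) (t : R) : 0 <= t <= 1 -> sq01 p -> sq01 q -> sq01 (seg p q t).
Proof.
move=> /andP[t0 t1] [/andP[p1 p2] /andP[p3 p4]] [/andP[q1 q2] /andP[q3 q4]].
have s0 : 0 <= 1 - t by lra.
by split; apply/andP; split; rewrite /seg /=; nra.
Qed.

Definition fill (g : G) (i : bool) (F : R -> R -> pt) (A B : R -> R * R) (T y t : R) : pt :=
  if t <= T then F y t else cell_map g i (seg (A y) (B y) (Num.min (t - T) 1)).

Lemma fill_open (g : G) (i : bool) (F : R -> R -> pt) (A B : R -> R * R) (T : R)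
    (U : set pt) (Y : set R) :
  cw_open U -> continuous A -> continuous B ->
  (forall y, sq01 (A y)) -> (forall y, sq01 (B y)) ->
  (forall y, Y y -> F y T = cell_map g i (A y)) ->
  relopen [set p : R * R | Y p.1 /\ 0 <= p.2] ((fun p => F p.1 p.2) @^-1` U) ->
  relopen [set p : R * R | Y p.1 /\ 0 <= p.2] ((fun p => fill g i F A B T p.1 p.2) @^-1` U).
Proof.
move=> [_ oU] cA cB sA sB e oF.
apply: (@relopen_if _ _ _ (fun p : R * R => p.2) T (fun p => F p.1 p.2)
  (fun p => cell_map g i (seg (A p.1) (B p.1) (Num.min (p.2 - T) 1)))).
- by prove_cont.
- move=> [y t] [/= Yy _] ->; rewrite subrr min_l ?ler01 // seg0; exact: e.
- by apply: relopen_sub oF => p [].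
apply: (@relopen_comp _ _ _ sq01 _ (cell_map g i @^-1` U)); last exact: oU.
  move=> [y t] [_ /= tT]; apply: seg_sq01 => //.
  by rewrite le_min ler01 subr_ge0 tT ge_min lexx orbT.
move=> p _; move: p.
have cf (C : R -> R * R) : continuous C -> ctn (fun p : R * R => (C p.1).1) /\
    ctn (fun p : R * R => (C p.1).2).
  move=> cC; split.
    by apply: (ctn_comp (f := fun p : R * R => C p.1) _ (@ctn_fst _ _));
      apply: ctn_comp cC; exact: ctn_fst.
  by apply: (ctn_comp (f := fun p : R * R => C p.1) _ (@ctn_snd _ _));
    apply: ctn_comp cC; exact: ctn_fst.
have [A1 A2] := cf _ cA; have [B1 B2] := cf _ cB.
have cm : ctn (fun p : R * R => Num.min (p.2 - T) 1) by ctn_rec.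
have cm' : ctn (fun p : R * R => 1 - Num.min (p.2 - T) 1) by ctn_rec.
refine (ctnW _); rewrite /seg; apply: ctn_pair;
  by apply: ctn_add; apply: ctn_mul.
Qed.

Lemma bd04 : bd 0 = bd 4.
Proof.
have h0 : 0 <= (0 : R) <= 4 by apply/andP; split; lra.
have h4 : 0 <= (4 : R) <= 4 by apply/andP; split; lra.
case: (bdE h0) => [] [? ->]; case: (bdE h4) => [] [? ->];
  first [by congr pair; lra | by exfalso; lra].
Qed.

(* Comb the other sides of the cell, then cross the cell along straight segments of the square.
   In the proof y in [0,1] runs over the edge k0, while p1 and p2 run over the positions of the
   other sides before and after it. *)
Lemma combed_cell (g : G) (i : bool) (k0 n : nat) (r := relator i) :
  (k0 < size r)%N ->
  (forall k, (k < size r)%N -> k != k0 ->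
     combed (gmul g (take k r)) [:: nth (false, false) r k] n) ->
  (forall k, (k <= size r)%N -> (groom (gmul g (take k r)) <= n)%N) ->
  (exists2 k, (k <= size r)%N & (n <= groom (gmul g (take k r)))%N) ->
  combed (gmul g (take k0 r)) [:: nth (false, false) r k0] n.
Proof.
move=> k0r hE hn hx.
set v0 := gmul g (take k0 r); pose v1 := gmul g (take k0.+1 r).
have ev1 : gmul v0 [:: nth (false, false) r k0] = v1.
  by rewrite /v0 /v1 gmul_cat cats1 -take_nth.
have [H1 [T1 [a1 a2 a3 a4 a5]]] : combed g (take k0 r) n.
  apply: combed_word; first by have := hn 0%N isT; rewrite take0 gmul_nil.
  move=> k; rewrite size_takel ?(ltnW k0r) // => kk; rewrite nth_take // take_takel; last exact: ltnW.
  by apply: hE; [exact: ltn_trans k0r|rewrite ltn_eqF].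
have [H2 [T2 [b1 b2 b3 b4 b5]]] : combed v1 (drop k0.+1 r) n.
  apply: combed_word; first exact: hn.
  move=> k; rewrite size_drop ltn_subRL => kk; rewrite nth_drop /v1 gmul_cat.
  have -> : take k0.+1 r ++ take k (drop k0.+1 r) = take (k0.+1 + k) r.
    by rewrite takeD.
  by apply: hE => //; rewrite gtn_eqF // addSn ltnS leq_addr.
have end2 : gmul v1 (drop k0.+1 r) = g.
  by rewrite /v1 gmul_cat cat_take_drop gmul_relator.
pose N : R := (size r)%:R; pose a : R := k0%:R.
have N0 : 0 < N by exact: size_relator_gt0.
have a0 : 0 <= a by exact: ler0n.
have aN : a + 1 <= N by rewrite natr1 ler_nat.
have sz1 : (size (take k0 r))%:R = a by rewrite size_takel // ltnW.
have sz2 : (size (drop k0.+1 r))%:R = N - (a + 1) by rewrite size_drop natrB // natr1.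
rewrite end2 in b2; rewrite ?sz1 ?sz2 -/v0 in a2 a4 a5 b2 b4 b5.
pose bq (s : R) := bd (s * 4 / N).
have cbq (p : R -> R) : ctn p -> continuous (fun y => bq (p y)).
  move=> cp; apply: (ctn_comp (f := fun y => p y * 4 / N) _ cont_bd).
  by apply: ctn_mul; [apply: ctn_mul => //; ctn_rec|ctn_rec].
have ebq s : 0 <= s <= N -> cell_map g i (bq s) = loop_pt g r s by exact: cell_map_bd.
have sbq s : sq01 (bq s) by exact: bd_sq01.
(* [p1] goes from a down to 0 for y in [0,1/2], and [p2] from N down to a + 1 for y in [1/2,1]; they
   meet at the base vertex since [bq 0 = bq N]. *)
pose p1 (y : R) : R := a * (1 - 2 * y).
pose p2 (y : R) : R := N - (2 * y - 1) * (N - (a + 1)).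
pose B (y : R) := bq (a + y); pose A1 (y : R) := bq (p1 y); pose A2 (y : R) := bq (p2 y).
pose T : R := Num.max T1 T2.
have T0 : 0 <= T by rewrite le_max a3.
have TT1 : T1 <= T by rewrite le_max lexx.
have TT2 : T2 <= T by rewrite le_max lexx orbT.
pose F1 (y t : R) := H1 (p1 y) t; pose F2 (y t : R) := H2 (p2 y - (a + 1)) t.
have r1 y : 0 <= y <= 1/2 -> 0 <= p1 y <= a.
  by move=> /andP[? ?]; rewrite /p1; apply/andP; split; nra.
have r2 y : 1/2 <= y <= 1 -> 0 <= p2 y - (a + 1) <= N - (a + 1).
  by move=> /andP[? ?]; rewrite /p2; apply/andP; split; nra.
have eF1 y t : 0 <= y <= 1/2 -> T <= t -> F1 y t = cell_map g i (A1 y).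
  move=> /r1 hy tT; have /andP[y0 y1] := hy; rewrite /F1 /A1 a4 //; last exact: le_trans tT.
  rewrite ebq; last by apply/andP; split; lra.
  by rewrite -[in RHS](cat_take_drop k0 r) loop_pt_catl // sz1.
have eF2 y t : 1/2 <= y <= 1 -> T <= t -> F2 y t = cell_map g i (A2 y).
  move=> /r2 hy tT; have /andP[y0 y1] := hy; rewrite /F2 /A2 b4 //; last exact: le_trans tT.
  rewrite ebq; last by apply/andP; split; lra.
  rewrite /v1 -loop_pt_catr ?sz2 // cat_take_drop size_takel // -natr1 -/a.
  by congr loop_pt; lra.
pose H (y t : R) := if y <= 1/2 then fill g i F1 A1 B T y t else fill g i F2 A2 B T y t.
have bq0N : bq 0 = bq N by rewrite /bq !mul0r [N * 4]mulrC mulfK ?gt_eqF // bd04.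
have cA1 : continuous A1 by apply: cbq; rewrite /p1; ctn_rec.
have cA2 : continuous A2 by apply: cbq; rewrite /p2; ctn_rec.
have cB : continuous B by apply: (cbq (fun y => a + y)); ctn_rec.
exists H, (T + 1); split.
- move=> U oU; apply: (@relopen_if _ _ _ (fun p : R * R => p.1) (1/2)
    (fun p => fill g i F1 A1 B T p.1 p.2) (fun p => fill g i F2 A2 B T p.1 p.2)).
  + by prove_cont.
  + move=> [y t] [/= hy t0] ->; rewrite /fill.
    have -> : A1 (1/2) = A2 (1/2).
      rewrite /A1 /A2; have -> : p1 (1/2) = 0 by rewrite /p1; lra.
      by have -> : p2 (1/2) = N by rewrite /p2; lra.
    case: ifP => // _; rewrite /F1 /F2.
    have -> : p2 (1/2) - (a + 1) = N - (a + 1) by rewrite /p2; lra.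
    have -> : p1 (1/2) = 0 by rewrite /p1; lra.
    by have [-> _] := a2 t t0; have [_ ->] := b2 t t0.
  + apply: (@relopen_sub _ [set p : R * R | [set y : R | 0 <= y <= 1/2] p.1 /\ 0 <= p.2]).
      by move=> [y t] [[/= /andP[y0 _] t0] y1]; split=> //=; apply/andP.
    apply: fill_open => //; [by move=> y; exact: sbq|by move=> y; exact: sbq|by move=> y hy; exact: eF1|].
    apply: (@relopen_comp _ _ _ (strip (take k0 r)) (fun p : R * R => (p1 p.1, p.2))
      ((fun p => H1 p.1 p.2) @^-1` U)); last exact: a1.
      by move=> [y t] [/= hy t0]; split=> //=; rewrite sz1; exact: r1.
    by move=> p _; move: p; rewrite /p1; prove_cont.
  + apply: (@relopen_sub _ [set p : R * R | [set y : R | 1/2 <= y <= 1] p.1 /\ 0 <= p.2]).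
      by move=> [y t] [[/= /andP[_ y0] t0] y1]; split=> //=; apply/andP.
    apply: fill_open => //; [by move=> y; exact: sbq|by move=> y; exact: sbq|by move=> y hy; exact: eF2|].
    apply: (@relopen_comp _ _ _ (strip (drop k0.+1 r)) (fun p : R * R => (p2 p.1 - (a + 1), p.2))
      ((fun p => H2 p.1 p.2) @^-1` U)); last exact: b1.
      by move=> [y t] [/= hy t0]; split=> //=; rewrite sz2; exact: r2.
    by move=> p _; move: p; rewrite /p2; prove_cont.
- move=> t t0; rewrite ev1 /= /H.
  have h01 : (0 : R) <= 1/2 by lra.
  have h10 : ((1 : R) <= 1/2) = false by apply/negbTE; rewrite -ltNge; lra.
  have e1 : p1 0 = a by rewrite /p1; lra.
  have e2 : p2 1 = a + 1 by rewrite /p2; lra.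
  rewrite h01 h10; split; rewrite /fill; case: ifPn => tT.
  + by rewrite /F1 e1; have [_ ->] := a2 t t0.
  (* At an end of the edge the crossing segment is constant, so the path of that vertex is
     unchanged. *)
  + rewrite /A1 /B addr0 e1 segxx; move: tT; rewrite -ltNge => /ltW tT.
    rewrite ebq; last by apply/andP; split; lra.
    have [_ <-] := a2 t t0; rewrite a4 ?a0 ?lexx //; last exact: le_trans tT.
    by rewrite -sz1 !loop_pt_vertex size_takel ?(ltnW k0r) // take_takel.
  + by rewrite /F2 e2 subrr; have [-> _] := b2 t t0.
  + rewrite /A2 /B e2 segxx; move: tT; rewrite -ltNge => /ltW tT.
    rewrite ebq; last by apply/andP; split; lra.
    have [<- _] := b2 t t0; rewrite b4 ?loop_pt0; last exact: le_trans tT.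
      by rewrite natr1 loop_pt_vertex.
    by apply/andP; split; lra.
- lra.
- move=> y t hy tT; have /andP[y0 y1] := hy.
  have tT' : (t <= T) = false by apply/negbTE; rewrite -ltNge; lra.
  have e1 : Num.min (t - T) 1 = 1 by apply: min_r; lra.
  rewrite /H /fill tT' e1 !seg1 if_same /B ebq; last by move: y1 => /= ?; apply/andP; split; lra.
  by rewrite loop_pt_edge // loop_pt_letter.
- move=> y hy; have /andP[y0 y1] := hy.
  have tame (nu : R -> nat) F A : (forall y, sq01 (A y)) ->
      (forall t t', 0 <= t -> t <= t' -> (nu t <= nu t')%N) ->
      (forall t, 0 <= t -> at_level (nu t) (F y t) /\ (nu t <= n)%N) ->
      tame_path n (fill g i F A B T y).
    (* During the crossing [nu] is set to n: this respects monotonicity since [nu] was at most n,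
       and by [cell_level] the whole closed cell is at level n. *)
    move=> sA mn ln; exists (fun t => if t <= T then nu t else n); split=> [t t' t0 tt'|t t0].
      case: ifP => tT; case: ifP => tT' //; first exact: mn.
        by have [] := ln t t0.
      by move: (le_trans tt' tT'); rewrite tT.
    rewrite /fill; case: ifPn => tT; first exact: ln.
    split=> //; apply: cell_level => //.
    apply: seg_sq01; [|exact: sA|exact: sbq]; move: tT; rewrite -ltNge => tT.
    by rewrite le_min ler01 subr_ge0 (ltW tT) ge_min lexx orbT.
  rewrite /H; case: (lerP y (1/2)) => hy2.
    have [|h5 [nu [n1 n2]]] := a5 (p1 y); first by apply: r1; apply/andP.
    by split; [rewrite /fill T0|apply: (tame nu F1 A1) => // z; exact: sbq].
  have [|h5 [nu [n1 n2]]] := b5 (p2 y - (a + 1)); first by apply: r2; apply/andP; split => //; exact: ltW.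
  by split; [rewrite /fill T0|apply: (tame nu F2 A2) => // z; exact: sbq].
Qed.

(** Second use of [flow_ind]. Edges of the group are recovered from edges between states by
    [gst_inj], and the room condition on the cell gives the bound at all its vertices. *)
Lemma combed_all (g : G) (a : letter) : combed g [:: a] (maxn (groom g) (groom (gmul g [:: a]))).
Proof.
suff H s b : supported s -> forall h, gst h = s ->
    combed h [:: b] (maxn (groom h) (groom (gmul h [:: b]))) by exact: (H (gst g) a (supported_gst g)).
move: s b; apply: flow_ind => [s b ts IH h eh|s ts s0 h eh|s i k0 ts k0r IH hr h eh].
- pose k := gmul h [:: linv b].
  have ek : gmul k [:: b] = h by have := gmul_linvK h (linv b); rewrite linvK.
  have := combed_rev (IH k _); rewrite ek -/k maxnC; apply.
  by rewrite /k gst_gmul eh /= act_linvK.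
- set b := toward s; pose p := gmul h [:: b].
  have ep : gmul p [:: linv b] = h by exact: gmul_linvK.
  have gp : gst p = parent s by rewrite gst_gmul eh.
  have := @combed_tree p (linv b); rewrite ep /gword eh gp => /(_ (nform_parent ts s0)).
  move/combed_rev; rewrite ep linvK; apply: combed_leq; exact: leq_maxl.
set r := relator i in k0r IH hr eh *.
pose g0 := cls (nform s); have eg0 : gst g0 = s by rewrite gst_cls acts_nform.
pose v k := gmul g0 (take k r).
have gv k : gst (v k) = acts (take k r) s by rewrite gst_gmul eg0.
have eh' : h = v k0 by apply: gst_inj; rewrite eh gv.
have vS k : (k < size r)%N -> gmul (v k) [:: nth (false, false) r k] = v k.+1.
  by move=> kr; rewrite /v gmul_cat cats1 -take_nth.
set n := maxn _ _; have en : n = maxn (groom (v k0)) (groom (v k0.+1)).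
  by rewrite /n eh' vS.
have hn k : (k <= size r)%N -> (groom (v k) <= n)%N.
  rewrite en /groom !gv leq_eqVlt => /orP[/eqP ->|]; last exact: hr.
  rewrite take_size acts_relator //; have := hr 0%N; rewrite take0; apply.
  exact: leq_ltn_trans k0r.
rewrite eh'; apply: combed_cell => //.
  move=> k kr kk0; apply: combed_leq (IH k kr kk0 (v k) (gv k)).
  by rewrite vS // geq_max !hn // ltnW.
have [h1|h1] := leqP (groom (v k0)) (groom (v k0.+1)).
  by exists k0.+1 => //; rewrite en (maxn_idPr h1).
by exists k0; [exact: ltnW|rewrite en (maxn_idPl (ltnW h1))].
Qed.

(** * Assembling the 1-combing *)

Lemma cont_inv_at (K : realType) (T : topologicalType) (f : T -> K) (x : T) :
  {for x, continuous f} -> f x != 0 -> {for x, continuous (fun y => (f y)^-1)}.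
Proof. by move=> cf f0; exact: cvgV. Qed.

Lemma cont_mul_at (K : realType) (T : topologicalType) (f g : T -> K) (x : T) :
  {for x, continuous f} -> {for x, continuous g} -> {for x, continuous (fun y => f y * g y)}.
Proof. by move=> cf cg; exact: cvgM. Qed.

Lemma cont_pair_at (T U V : topologicalType) (f : T -> U) (g : T -> V) (x : T) :
  {for x, continuous f} -> {for x, continuous g} -> {for x, continuous (fun y => (f y, g y))}.
Proof. by move=> cf cg; exact: cvg_pair. Qed.

Lemma X1_edge (x : pt) : X1 x -> exists g j y, 0 <= y <= 1 /\ x = edge_map g j y.
Proof.
case: x => [g|g j [y hy]|//] _.
  by exists g, false, 0; rewrite edge_map0 lexx ler01.
exists g, j, y; split; first by case/andP: (hy) => /ltW -> /ltW ->.
by rewrite edge_mapE // /mkE insubT.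
Qed.

Definition sq : set (R * R) := [set p | I01 p.1 /\ I01 p.2].

(* A tube-lemma argument: the points of X1 mapped into an open set during a whole compact
   time interval form a set which is open in every edge. *)
Lemma continuous_edgewise (Psi : pt -> R -> pt) :
  (forall U, cw_open U -> forall g j,
     relopen sq ((fun p : R * R => Psi (edge_map g j p.1) p.2) @^-1` U)) ->
  {within [set p : pt * R | X1 p.1 /\ I01 p.2], continuous (fun p : pt * R => Psi p.1 p.2)}.
Proof.
move=> hPsi; apply/subspace_continuousP => -[x0 s0] [/= Xx0 Is0] B.
rewrite nbhsE => -[U [oU Ux] UB].
have {}oU : cw_open U by [].
have [g0 [j0 [y0 [hy0 ex0]]]] := X1_edge Xx0.
have n1 : \forall s \near s0, I01 s -> U (Psi x0 s).
  have := hPsi U oU g0 j0 (y0, s0) (conj hy0 Is0); rewrite /preimage /= -ex0 => /(_ Ux) h.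
  have c : {for s0, continuous (fun s : R => (y0, s))} by move: (s0); prove_cont.
  have : \forall s \near s0, sq (y0, s) -> U (Psi (edge_map g0 j0 y0) s) := c _ h.
  by rewrite -ex0; apply: near_sub => s hs Is; apply: hs.
have [e /= e0 he] := (proj1 (nbhs_ballP _ _) n1).
(* Half the radius keeps the closed interval J inside the ball. *)
pose d := e / 2; have d0 : 0 < d by rewrite divr_gt0.
pose J : set R := [set s | I01 s /\ s0 - d <= s <= s0 + d].
have cJ : compact J.
  have := @segment_compact R (Num.max 0 (s0 - d)) (Num.min 1 (s0 + d)).
  rewrite set_itvcc; set J' := (X in compact X); suff -> : J = J' by [].
  apply/seteqP; split=> s; rewrite /J /J' /I01 /= ge_max le_min.
    by move=> [/andP[-> ->] /andP[-> ->]].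
  by move=> /andP[/andP[-> ->] /andP[-> ->]].
have UJ s : J s -> U (Psi x0 s).
  move=> [Is /andP[s1 s2]]; apply: he => //=; rewrite /ball /= ltr_distl.
  by apply/andP; split; rewrite /d in s1 s2 d0; lra.
pose V : set pt := [set x | X1 x /\ forall s, J s -> U (Psi x s)].
have oV : graph_open V.
  move=> g j y Iy [_ Vy].
  pose P (y' s : R) := J s -> I01 y' -> U (Psi (edge_map g j y') s).
  have n2 : \forall y' \near y, forall s, J s -> P y' s.
    apply: (near_tube cJ) => s Js.
    have h := hPsi U oU g j (y, s) (conj Iy (proj1 Js)) (Vy s Js).
    have c : {for (s, y), continuous (fun z : R * R => (z.2, z.1))}.
      by move: (s, y); prove_cont.
    have : \forall z \near (s, y), sq (z.2, z.1) -> U (Psi (edge_map g j z.2) z.1) := c _ h.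
    by apply: near_sub => -[s' y'] /= hz [Is' _] Iy'; apply: hz.
  apply: near_sub n2 => y' h Iy'; split; first exact: (traverse_X1 g (j, false)).
  by move=> s Js; apply: h.
have oO := cw_open_extend oV.
have nx : nbhs x0 (V `|` ~` X1).
  rewrite nbhsE; exists (V `|` ~` X1) => //; split=> //; left; split=> // s; exact: UJ.
have ns : \forall s \near s0, s0 - d < s < s0 + d.
  have c : {for s0, continuous (fun s : R => s)} := @ctn_id R s0.
  have l1 : s0 - d < s0 by rewrite ltrBlDr ltrDl.
  have l2 : s0 < s0 + d by rewrite ltrDl.
  by apply: near_sub (near_and (near_gt (K := R) c l1) (near_lt (K := R) c l2)) => s [-> ->].
exists (V `|` ~` X1, [set s | s0 - d < s < s0 + d]) => // -[x s] /= [hx /andP[s1 s2]] [Xx Is].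
case: hx => [[_ hx]|//]; apply: UB; apply: hx; split=> //.
by apply/andP; split; exact: ltW.
Qed.

(** At both ends the homotopy is prescribed by [gpath], so independent choices for different edges
    agree at common vertices. *)
Definition edge_homotopy (e : G * bool) (f : (R -> R -> pt) * R) : Prop :=
  [/\ forall U, cw_open U -> relopen [set p : R * R | I01 p.1 /\ 0 <= p.2]
        ((fun p => f.1 p.1 p.2) @^-1` U),
      forall t, 0 <= t -> f.1 0 t = gpath e.1 t /\
        f.1 1 t = gpath (gmul e.1 [:: (e.2, false)]) t,
      0 <= f.2,
      forall y t, I01 y -> f.2 <= t -> f.1 y t = edge_map e.1 e.2 y &
      forall y, I01 y -> f.1 y 0 = PV eps /\ exists n, tame_path n (f.1 y)].

Lemma edge_homotopy_ex (e : G * bool) : exists f, edge_homotopy e f.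
Proof.
case: e => g j; have [H [T [h1 h2 h3 h4 h5]]] := combed_all g (j, false).
exists (H, T); split=> //=.
  by move=> y t Iy Tt; rewrite h4 // loop_pt_letter.
move=> y Iy; have [e t] := h5 y Iy; split=> //.
by exists (maxn (groom g) (groom (gmul g [:: (j, false)]))).
Qed.

Theorem theorem5p4 :
  exists Psi : pt -> R -> pt,
    one_combing Psi /\ radial_tameness Psi (fun q : rat => 4 * ratr q + 45).
Proof.
have [F hF] := choice edge_homotopy_ex.
(* Compresses the unbounded time of the homotopies into [0,1). *)
pose tau (s : R) : R := s / (1 - s).
have tau0 s : 0 <= s < 1 -> 0 <= tau s.
  by move=> /andP[s0 s1]; rewrite divr_ge0 // subr_ge0 ltW.
have tau_mono s s' : 0 <= s -> s <= s' -> s' < 1 -> tau s <= tau s'.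
  move=> s0 ss' s1; have p' : 0 < 1 - s' by lra.
  have p : 0 < 1 - s by lra.
  by rewrite /tau ler_pdivrMr // mulrAC ler_pdivlMr //; nra.
pose Psi (x : pt) (s : R) : pt := if 1 <= s then x else
  match x with
  | PV g => gpath g (tau s)
  | PE g j y => (F (g, j)).1 (val y) (tau s)
  | PC _ _ _ => x
  end.
have PsiE g j y s : I01 y -> 0 <= s ->
    Psi (edge_map g j y) s = if 1 <= s then edge_map g j y else (F (g, j)).1 y (tau s).
  move=> Iy s0; rewrite /Psi; case: ifPn => // s1.
  have t0 : 0 <= tau s by apply: tau0; rewrite s0 ltNge.
  have [_ /(_ _ t0) [e0 e1] _ _ _] := hF (g, j).
  have [->|n0] := eqVneq y 0; first by rewrite edge_map0 e0.
  have [->|n1] := eqVneq y 1; first by rewrite edge_map1 e1.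
  have hy : 0 < y < 1 by move: Iy; rewrite /I01 /= !lt_def n0 eq_sym n1.
  by rewrite edge_mapE // /mkE insubT.
have slow x s t : X1 x -> 0 <= s -> s < t -> t <= 1 ->
    lev (Psi x s) <= 4 * lev (Psi x t) + 45.
  move=> /X1_edge[g [j [y [Iy ->]]]] s0 st t1; rewrite !PsiE //; last by lra.
  have s1 : s < 1 by lra.
  have [_ _ T0 hT /(_ _ Iy) [_ [n [nu [mono lv]]]]] := hF (g, j).
  have ts0 : 0 <= tau s by apply: tau0; rewrite s0.
  have -> : (1 <= s) = false by apply/negbTE; rewrite -ltNge.
  have key u : tau s <= u -> lev ((F (g, j)).1 y (tau s)) <= 4 * lev ((F (g, j)).1 y u) + 45.
    move=> su; have u0 : 0 <= u by exact: le_trans su.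
    have [[l1 _] _] := lv _ ts0; have [[_ l2] _] := lv _ u0.
    have := mono _ _ ts0 su; rewrite -(ler_nat R) => l3; lra.
  case: ifPn => [_|t1']; last by apply: key; apply: tau_mono; rewrite ?ltNge //; exact: ltW.
  (* At time 1 the point x itself is the value of the homotopy at any time past its T, in particular
     at one not before [tau s]. *)
  rewrite -(hT y (Num.max (F (g, j)).2 (tau s)) Iy) ?le_max ?lexx //.
  by apply: key; rewrite le_max lexx orbT.
exists Psi; split; last first.
  move=> x s t q Xx s0 st t1 h; have := slow x s t Xx s0 st t1; move: h => /=; lra.
split; [|split; [|split]].
- apply: continuous_edgewise => U oU g j.
  have [oF _ T0 hT _] := hF (g, j); set T := (F (g, j)).2 in T0 hT.
  move=> [y s] [/= Iy Is]; rewrite /preimage /= => Us.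
  have /andP[s0 _] := Is; rewrite PsiE // in Us.
  have c2 : {for (y, s), continuous (fun p : R * R => p.2)} := @ctn_snd R R (y, s).
  have [s1|s1] := leP 1 s.
    have Ve : U (edge_map g j y) by rewrite s1 in Us.
    have nU : \forall p \near (y, s), I01 p.1 -> U (edge_map g j p.1).
      have nV : \forall y' \near y, I01 y' -> U (edge_map g j y') := @cw_open_graph U oU g j y Iy Ve.
      exact: (@ctn_fst R R (y, s) _ nV).
    have T1 : 0 < 1 + T by rewrite ltr_pwDl.
    (* [tau] takes the value T at [T / (1 + T)]; beyond it every path along this edge has
       arrived. *)
    have lT : T / (1 + T) < s by apply: lt_le_trans s1; rewrite ltr_pdivrMr // mul1r ltrDr.
    apply: near_sub (near_and nU (near_gt (K := R) c2 lT)) => -[y' s'] /= [hU hs] [/= Iy' /andP[s0' _]].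
    rewrite PsiE //; case: ifPn => [_|s1']; first exact: hU.
    rewrite hT //; first exact: hU.
    rewrite -ltNge in s1'; rewrite ler_pdivlMr ?subr_gt0 //.
    by move: hs; rewrite ltr_pdivrMr //; nra.
  have Ut : U ((F (g, j)).1 y (tau s)) by move: Us; rewrite leNgt s1.
  have h : relopen [set p : R * R | I01 p.1 /\ 0 <= p.2 < 1]
      ((fun p : R * R => (F (g, j)).1 p.1 (tau p.2)) @^-1` U).
    apply: (@relopen_comp _ _ _ [set p : R * R | I01 p.1 /\ 0 <= p.2]
      (fun p : R * R => (p.1, tau p.2)) ((fun p => (F (g, j)).1 p.1 p.2) @^-1` U)).
    + by move=> [y' s'] /= [Iy' hs']; split=> //; exact: tau0.
    + move=> [y' s'] /= [_ /andP[_ s1']]; apply: cont_pair_at; first exact: ctn_fst.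
      have c3 : {for (y', s'), continuous (fun p : R * R => 1 - p.2)} by move: (y', s'); prove_cont.
      apply: (@cont_mul_at R); first exact: ctn_snd.
      by apply: (@cont_inv_at R _ _ _ c3); rewrite subr_eq0 gt_eqF.
    + exact: oF.
  have nh := h (y, s) (conj Iy (introT andP (conj s0 s1))) Ut.
  apply: near_sub (near_and nh (near_lt (K := R) c2 s1)) => -[y' s'] /= [hU hs] [/= Iy' /andP[s0' _]].
  rewrite PsiE // leNgt hs; apply: hU; split=> //; exact/andP.
- move=> x /X1_edge[g [j [y [Iy ->]]]]; rewrite PsiE // ler10.
  by rewrite /tau mul0r; have [_ _ _ _ /(_ _ Iy) [-> _]] := hF (g, j).
- by move=> x _; rewrite /Psi lexx.
move=> [g| |] //= s _ _; rewrite /Psi; case: ifP => // _; exact: loop_pt_X1.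
Qed.
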